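(* Let $n\ge1$, let $\boldsymbol{L}\in\mathbb{R}^{n\times n}$ be Hurwitz, and for $m=1,\dots,n$ let $\boldsymbol{R}_m\in\mathbb{R}^{n\times n}$ be symmetric; define $\boldsymbol{\Upsilon}:\mathbb{R}^n\to\mathbb{R}^n$ by $\Upsilon_m(\boldsymbol{a})=\boldsymbol{a}^T\boldsymbol{R}_m\boldsymbol{a}$, with $\boldsymbol{a}^T\boldsymbol{\Upsilon}(\boldsymbol{a})=0$ for all $\boldsymbol{a}$. Consider the input-output system $$\dot{\boldsymbol{a}}=\boldsymbol{L}\boldsymbol{a}+\boldsymbol{\Upsilon}(\boldsymbol{a})+\boldsymbol{f}(t),\qquad\boldsymbol{y}=\boldsymbol{a},\qquad\boldsymbol{a}(0)=\boldsymbol{a}_0.$$ Let $\delta>0$ and let $D\subseteq\mathbb{R}^n$ contain $\{\boldsymbol{a}:\|\boldsymbol{a}\|\le\delta\}$. Suppose there exist a symmetric matrix $\boldsymbol{P}_{\text{SOS}}\in\mathbb{R}^{n\times n}$, a scalar $\varepsilon>0$ and a matrix $\boldsymbol{Q}\succeq0$ such that, with $V_{\text{SOS}}(\boldsymbol{a}):=\boldsymbol{a}^T\boldsymbol{P}_{\text{SOS}}\boldsymbol{a}$, for all $\boldsymbol{a}\in D$: $$V_{\text{SOS}}(\boldsymbol{a})-\varepsilon\boldsymbol{a}^T\boldsymbol{a}\ge0,\qquad -\Big(\tfrac{\partial V_{\text{SOS}}}{\partial\boldsymbol{a}}(\boldsymbol{L}\boldsymbol{a}+\boldsymbol{\Upsilon}(\boldsymbol{a}))+(\delta^2-\boldsymbol{a}^T\boldsymbol{a})\,\boldsymbol{a}^T\boldsymbol{Q}\boldsymbol{a}+\varepsilon\boldsymbol{a}^T\boldsymbol{a}\Big)\ge0.$$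 Let $\lambda_{\min},\lambda_{\max}$ denote the extreme eigenvalues of $\boldsymbol{P}_{\text{SOS}}$ and $\|2\boldsymbol{P}_{\text{SOS}}\|$ the spectral norm of $2\boldsymbol{P}_{\text{SOS}}$. Then for each $\boldsymbol{a}_0$ with $\|\boldsymbol{a}_0\|\le\delta\sqrt{\lambda_{\min}/\lambda_{\max}}$ the system is small-signal finite-gain $\mathcal{L}_p$ stable for each $p\in[1,\infty]$. In particular, for each $\tau\ge0$ and each $\boldsymbol{f}\in\mathcal{L}_{pe}$ with $$\sup_{0\le t\le\tau}\|\boldsymbol{f}(t)\|\le\frac{\lambda_{\min}\,\varepsilon\,\delta}{\lambda_{\max}\,\|2\boldsymbol{P}_{\text{SOS}}\|},$$ the state satisfies $\|\boldsymbol{a}(t)\|\le\delta$ for all $t\in[0,\tau]$ and the output satisfies $\|\boldsymbol{y}_\tau\|_{\mathcal{L}_p}\le\gamma_{\text{SOS}}\|\boldsymbol{f}_\tau\|_{\mathcal{L}_p}+\beta_{\text{SOS}}$, where $$\gamma_{\text{SOS}}=\frac{\lambda_{\max}\|2\boldsymbol{P}_{\text{SOS}}\|}{\lambda_{\min}\,\varepsilon},\qquad\beta_{\text{SOS}}=\|\boldsymbol{a}_0\|\sqrt{\frac{\lambda_{\max}}{\lambda_{\min}}}\,\rho,\qquad\rho=\begin{cases}1,&p=\infty,\\ \left(\frac{2\lambda_{\max}}{\varepsilon p}\right)^{1/p},&p\in[1,\infty).\end{cases}$$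
   Context: $\|\cdot\|$ denotes the Euclidean norm on $\mathbb{R}^n$. For a signal $\boldsymbol{g}:[0,\infty)\to\mathbb{R}^n$ and $\tau\ge0$, the truncation is $\boldsymbol{g}_\tau(t)=\boldsymbol{g}(t)$ for $0\le t\le\tau$ and $\boldsymbol{g}_\tau(t)=\boldsymbol{0}$ for $t>\tau$. For $p\in[1,\infty)$, $\|\boldsymbol{g}\|_{\mathcal{L}_p}=(\int_0^\infty\|\boldsymbol{g}(t)\|^p\,dt)^{1/p}$, and $\|\boldsymbol{g}\|_{\mathcal{L}_\infty}=\sup_{t\ge0}\|\boldsymbol{g}(t)\|$. $\mathcal{L}_p$ is the set of piecewise continuous $\boldsymbol{g}:[0,\infty)\to\mathbb{R}^n$ with finite $\mathcal{L}_p$ norm, and $\mathcal{L}_{pe}=\{\boldsymbol{g}:\boldsymbol{g}_\tau\in\mathcal{L}_p\ \forall\tau\in[0,\infty)\}$. A matrix is Hurwitz if all its eigenvalues have negative real part. ''Small-signal finite-gain $\mathcal{L}_p$ stable'' means there exist constants $r>0$, $\gamma\ge0$, $\beta\ge0$ such that every input with $\sup_{0\le t\le\tau}\|\boldsymbol{f}(t)\|\le r$ yields $\|\boldsymbol{y}_\tau\|_{\mathcal{L}_p}\le\gamma\|\boldsymbol{f}_\tau\|_{\mathcal{L}_p}+\beta$; the explicit bounds are given in the claim. *)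

(* Defs.v *)
From HB Require Import structures.
From mathcomp Require Import all_boot all_order all_algebra.
From mathcomp Require Import all_classical all_reals all_analysis.
From mathcomp Require Import complex.
Set Implicit Arguments. Unset Strict Implicit. Unset Printing Implicit Defensive.
Import Order.TTheory GRing.Theory Num.Theory.
Import numFieldNormedType.Exports.
Local Open Scope classical_set_scope.
Local Open Scope ring_scope.

Section Defs.
Variable R : realType.
Variable n : nat.

Definition vnorm (v : 'cV[R]_n) : R := Num.sqrt (\sum_i (v i 0) ^+ 2).

Definition qform (M : 'M[R]_n) (a : 'cV[R]_n) : R := (a^T *m M *m a) 0 0.

Definition Ups (Rs : 'I_n -> 'M[R]_n) (a : 'cV[R]_n) : 'cV[R]_n :=
  \col_m qform (Rs m) a.

Definition symmx (M : 'M[R]_n) : Prop := M^T = M.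

Definition psd (M : 'M[R]_n) : Prop := symmx M /\ forall x, 0 <= qform M x.

Definition hurwitz (L : 'M[R]_n) : Prop :=
  forall z : R[i], eigenvalue (map_mx (fun x => x%:C%C) L) z -> (Re z < 0).

Definition is_lambda_min (M : 'M[R]_n) (l : R) : Prop :=
  eigenvalue M l /\ forall x, eigenvalue M x -> l <= x.
Definition is_lambda_max (M : 'M[R]_n) (l : R) : Prop :=
  eigenvalue M l /\ forall x, eigenvalue M x -> x <= l.

Definition specnorm (M : 'M[R]_n) : R :=
  sup [set vnorm (M *m x) | x in [set x | vnorm x <= 1]].

Definition trunc (g : R -> 'cV[R]_n) (tau : R) : R -> 'cV[R]_n :=
  fun t => if t <= tau then g t else 0.

Definition sigLp (p : \bar R) (g : R -> 'cV[R]_n) : \bar R :=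
  match p with
  | p'%:E => poweR (\int[lebesgue_measure]_(t in `[0, +oo[) ((vnorm (g t)) `^ p')%:E) p'^-1
  | +oo%E => ereal_sup [set (vnorm (g t))%:E | t in `[0, +oo[]
  | -oo%E => 0%E
  end.

Definition piecewise_continuous (g : R -> 'cV[R]_n) : Prop :=
  forall T, 0 < T -> exists s : seq R,
    (forall t, 0 < t < T -> t \notin s -> {for t, continuous g}) /\
    (forall t, 0 <= t < T -> (t \in s) || (t == 0) ->
        exists l : 'cV[R]_n, g x @[x --> t^'+] --> l) /\
    (forall t, 0 < t <= T -> (t \in s) || (t == T) ->
        exists l : 'cV[R]_n, g x @[x --> t^'-] --> l).

Definition Lpe (p : \bar R) (g : R -> 'cV[R]_n) : Prop :=
  piecewise_continuous g /\ forall tau, 0 <= tau -> (sigLp p (trunc g tau) < +oo)%E.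

(* a is a (Caratheodory / integral-form) solution on [0, +oo) of
   a' = L a + Ups(a) + f(t), a(0) = a0 *)
Definition is_solution (L : 'M[R]_n) (Rs : 'I_n -> 'M[R]_n)
  (f : R -> 'cV[R]_n) (a0 : 'cV[R]_n) (a : R -> 'cV[R]_n) : Prop :=
  {within `[0, +oo[, continuous a} /\
  forall t, 0 <= t -> forall i : 'I_n,
    a t i 0 = a0 i 0 + Rintegral lebesgue_measure `[0, t]
                  (fun s => (L *m a s + Ups Rs (a s) + f s) i 0).

Definition rho (p : \bar R) (lmax eps : R) : R :=
  match p with
  | p'%:E => ((2 * lmax) / (eps * p')) `^ p'^-1
  | _ => 1
  end.

Definition Vsos (P : 'M[R]_n) : 'cV[R]_n -> R := qform P.

End Defs.

(* Main.v *)
(** With [W = sqrt (V a)], [c = eps / (2 lmax)], [k = N / (2 sqrt lmin)] and [N]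
    the spectral norm of [2 P], dissipation in the ball gives
    [W' <= - c W + k |f|].  The input is only piecewise continuous, so all
    derivatives are right (Dini) derivatives, which exist everywhere because [f]
    has right limits.

    Invariance of the sublevel set [V <= lmin delta^2]: on its boundary [V'] is
    only [<= 0], not [< 0], so we use that just outside of it
    [V' <= K (V - lmin delta^2)] and conclude by a Gronwall argument.

    The bound for [p = oo] is a comparison argument.  For finite [p] no
    convolution estimate is needed: integrating
    [(W^p)' <= p W^(p-1) (- c W + k |f|)] and using Young's inequality with weight
    [m] gives, for [I], [J] the integrals of [W^p] and [|f|^p],
    [(p c - (p-1) k m) I <= W(0)^p + k m^(1-p) J];
    the choice [m = (J / I)^(1/p)] turns it into
    [X^p <= B^p + G X^(p-1)] with [X = I^(1/p)], [B = W(0) (c p)^(-1/p)],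
    [G = (k / c) J^(1/p)], whence [X <= B + G]. *)

Require Import Defs.
From HB Require Import structures.
From mathcomp Require Import all_boot all_order all_algebra.
From mathcomp Require Import all_classical all_reals all_analysis.
From mathcomp Require Import complex.
From mathcomp Require Import measurable_realfun ring lra.
Import Order.TTheory GRing.Theory Num.Theory.
Import numFieldNormedType.Exports.
Local Open Scope classical_set_scope.
Local Open Scope ring_scope.

(** * Quadratic forms, extreme eigenvalues and the spectral norm *)

Section LinearAlgebra.
Context {R : realType} {n : nat}.
Implicit Types (x y : 'cV[R]_n) (A M P : 'M[R]_n).

Definition bform M x y : R := (x^T *m M *m y) 0 0.

Lemma bformDl M x1 x2 y : bform M (x1 + x2) y = bform M x1 y + bform M x2 y.
Proof. by rewrite /bform raddfD /= !mulmxDl mxE. Qed.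

Lemma bformDr M x y1 y2 : bform M x (y1 + y2) = bform M x y1 + bform M x y2.
Proof. by rewrite /bform !mulmxDr mxE. Qed.

Lemma bformZl M r x y : bform M (r *: x) y = r * bform M x y.
Proof. by rewrite /bform linearZ /= -!scalemxAl mxE. Qed.

Lemma bformZr M r x y : bform M x (r *: y) = r * bform M x y.
Proof. by rewrite /bform -!scalemxAr mxE. Qed.

Lemma bformC M x y : symmx M -> bform M x y = bform M y x.
Proof.
move=> sM; rewrite /bform -[in RHS](trmxK M) sM.
by rewrite -[LHS](mxE trmx_key (fun i j => (x^T *m M *m y) j i)) -/(trmx _)
  !trmx_mul trmxK mulmxA.
Qed.

Lemma qformE M x : qform M x = bform M x x. Proof. by []. Qed.

Lemma qformZ M r x : qform M (r *: x) = r ^+ 2 * qform M x.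
Proof. by rewrite !qformE bformZl bformZr; ring. Qed.

Lemma bform_scalar r x y : bform r%:M x y = r * (x^T *m y) 0 0.
Proof. by rewrite /bform mul_mx_scalar -scalemxAl mxE. Qed.

Lemma bform_sum M x y :
  bform M x y = \sum_j \sum_i x i 0 * M i j * y j 0.
Proof.
rewrite /bform mxE; apply: eq_bigr => j _; rewrite mxE mulr_suml.
by apply: eq_bigr => i _; rewrite mxE.
Qed.

Lemma sqr_vnorm x : vnorm x ^+ 2 = (x^T *m x) 0 0.
Proof.
rewrite /vnorm sqr_sqrtr ?sumr_ge0// => [|i _]; last exact: sqr_ge0.
by rewrite mxE; apply: eq_bigr => i _; rewrite mxE expr2.
Qed.

Lemma vnorm_ge0 x : 0 <= vnorm x. Proof. exact: sqrtr_ge0. Qed.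

Lemma vnorm0 : vnorm (0 : 'cV[R]_n) = 0.
Proof. by rewrite /vnorm big1 ?sqrtr0// => i _; rewrite mxE expr0n. Qed.

Lemma vnorm_eq0 x : vnorm x = 0 -> x = 0.
Proof.
move=> x0; have : \sum_i x i 0 ^+ 2 = 0.
  rewrite -(@sqr_sqrtr _ (\sum_i x i 0 ^+ 2)) ?sumr_ge0// => [|i _].
    by rewrite -/(vnorm x) x0 expr0n.
  exact: sqr_ge0.
move=> /eqP; rewrite psumr_eq0 => [|i _]; last exact: sqr_ge0.
move=> /allP x0'; apply/colP => i; rewrite mxE; apply/eqP.
by have := x0' i (mem_index_enum _); rewrite /= sqrf_eq0.
Qed.

Lemma vnormZ r x : vnorm (r *: x) = `|r| * vnorm x.
Proof.
apply/eqP; rewrite -(@eqrXn2 _ 2)// ?mulr_ge0 ?vnorm_ge0//.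
rewrite exprMn !sqr_vnorm -[X in X == _]mul1r -[in X in _ == X](mul1r (_ 0 0)).
by rewrite -!bform_scalar bformZl bformZr real_normK ?num_real// mulrA -expr2.
Qed.

Lemma ler_coord_vnorm x i : `|x i 0| <= vnorm x.
Proof.
rewrite -(sqrtr_sqr (x i 0)) ler_sqrt ?sumr_ge0// => [|j _]; last exact: sqr_ge0.
rewrite (bigD1 i)//= lerDl sumr_ge0// => j _; exact: sqr_ge0.
Qed.

(** A crude entrywise estimate, for the places where only the finiteness of a supremum or the
    existence of a constant matters. The added [1] keeps the constant positive, hence invertible. *)
Lemma qform_bound M : exists2 C : R, 0 < C & forall x, `|qform M x| <= C * vnorm x ^+ 2.
Proof.
exists (1 + \sum_j \sum_i `|M i j|).
  by rewrite ltr_pwDl// sumr_ge0// => j _; rewrite sumr_ge0.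
move=> x; rewrite /qform mxE.
rewrite (@le_trans _ _ ((\sum_j \sum_i `|M i j|) * vnorm x ^+ 2))//; last first.
  by rewrite ler_wpM2r ?exprn_ge0 ?vnorm_ge0// lerDr.
rewrite (le_trans (ler_norm_sum _ _ _))// mulr_suml ler_sum// => j _.
rewrite mxE normrM.
rewrite (@le_trans _ _ ((\sum_i `|M i j|) * vnorm x * vnorm x))//; last first.
  by rewrite expr2 mulrA.
rewrite ler_pM ?ler_coord_vnorm//.
rewrite (le_trans (ler_norm_sum _ _ _))// mulr_suml ler_sum// => i _.
by rewrite mxE normrM mulrC ler_wpM2l ?ler_coord_vnorm.
Qed.

(** The quadratic polynomial [qform M (x + r *: y)] in [r] is nonnegative; its value at the
    minimiser gives the inequality. *)
Lemma psd_CauchySchwarz M x y : psd M ->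
  bform M x y ^+ 2 <= qform M x * qform M y.
Proof.
move=> [sM pM].
have E r : qform M (x + r *: y) =
    qform M x + 2 * r * bform M x y + r ^+ 2 * qform M y.
  rewrite !qformE !bformDl !bformDr !bformZl !bformZr (bformC _ y x)//; ring.
have [y0|y0] := eqVneq (qform M y) 0.
  have [->|b0] := eqVneq (bform M x y) 0; first by rewrite expr0n/= mulr_ge0.
  (* With [qform M y = 0] the polynomial is affine in [r], and this [r] gives it the value [-1]. *)
  exfalso; have := pM (x + (- (qform M x + 1) / (2 * bform M x y)) *: y).
  rewrite E y0 mulr0 addr0.
  have -> : 2 * (- (qform M x + 1) / (2 * bform M x y)) * bform M x y =
    - (qform M x + 1) by field.
  by lra.
have yp : 0 < qform M y by rewrite lt_def y0 pM.
have := pM (x + (- bform M x y / qform M y) *: y); rewrite E.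
rewrite -(pmulr_lge0 _ yp) => H; rewrite -subr_ge0.
by apply: le_trans H _; rewrite le_eqVlt; apply/orP; left; apply/eqP; field.
Qed.

Lemma psd1 : psd (1%:M : 'M[R]_n).
Proof.
split; first exact: trmx1.
by move=> x; rewrite qformE bform_scalar mul1r -sqr_vnorm exprn_ge0 ?vnorm_ge0.
Qed.

Lemma dot_le x y : (x^T *m y) 0 0 <= vnorm x * vnorm y.
Proof.
have := psd_CauchySchwarz _ x y psd1.
rewrite !qformE !bform_scalar !mul1r -!sqr_vnorm -exprMn => H.
rewrite (le_trans (ler_norm _))// -(@ler_pXn2r _ 2)// ?nnegrE ?mulr_ge0 ?vnorm_ge0//.
by rewrite real_normK// num_real.
Qed.

(** [eigenvalue] speaks of row vectors; by symmetry the transpose of a left eigenvector is a right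
    one, which is then normalised. *)
Lemma eigenvalue_symm P l : symmx P -> eigenvalue P l ->
  exists2 v, vnorm v = 1 & P *m v = l *: v.
Proof.
move=> sP /eigenvalueP[v vP v0].
have n0 : vnorm v^T != 0.
  apply: contra v0 => /eqP /vnorm_eq0 /(congr1 trmx); rewrite trmxK => ->.
  by rewrite trmx0.
exists ((vnorm v^T)^-1 *: v^T).
  by rewrite vnormZ ger0_norm ?invr_ge0 ?vnorm_ge0// mulVf.
rewrite -scalemxAr -[P in LHS]trmxK -trmx_mul sP vP linearZ/=.
by rewrite !scalerA mulrC.
Qed.

Lemma qform_eigenvector P l v : P *m v = l *: v -> qform P v = l * vnorm v ^+ 2.
Proof. by move=> Pv; rewrite /qform -mulmxA Pv -scalemxAr mxE sqr_vnorm. Qed.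

(* If [M = m - P], with [m] the supremum of the Rayleigh quotient, were
   invertible, Cauchy-Schwarz for [M] between [x] and [M^-1 x] would bound
   [|x|^2] by a multiple of [qform M x], contradicting the choice of [m]. *)
Lemma qform_le_lambda_max P l x : symmx P -> is_lambda_max P l ->
  qform P x <= l * vnorm x ^+ 2.
Proof.
move=> sP [el ml].
(* The unit eigenvector makes the set [S] below nonempty. *)
have [v v1 _] := eigenvalue_symm _ _ sP el.
pose S := [set qform P x | x in [set x | vnorm x = 1]].
have [C C0 hC] := qform_bound P.
have S0 : has_sup S.
  split; first by exists (qform P v), v.
  exists C => _ [z /= z1 <-]; rewrite (le_trans (ler_norm _))//.
  by rewrite (le_trans (hC z))// z1 expr1n mulr1.
have ubS z : qform P z <= sup S * vnorm z ^+ 2.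
  have [z0|z0] := eqVneq (vnorm z) 0.
    by rewrite (vnorm_eq0 _ z0) vnorm0 expr0n mulr0 qformE -(scale0r 0) bformZl mul0r.
  have : qform P ((vnorm z)^-1 *: z) <= sup S.
    apply: ub_le_sup; first exact: S0.2.
    exists ((vnorm z)^-1 *: z) => //=.
    by rewrite vnormZ ger0_norm ?invr_ge0 ?vnorm_ge0// mulVf.
  rewrite qformZ -ler_pdivlMl ?exprn_gt0 ?invr_gt0 ?lt_def ?z0 ?vnorm_ge0//.
  by rewrite -exprVn invrK mulrC.
pose M := (sup S)%:M - P.
have qM z : qform M z = sup S * vnorm z ^+ 2 - qform P z.
  rewrite /qform /M mulmxBr mulmxBl mxE [X in _ + X]mxE; congr (_ - _).
  by rewrite -/(bform _ _ _) bform_scalar sqr_vnorm.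
have psdM : psd M.
  split=> [|z]; last by rewrite qM subr_ge0.
  by rewrite /symmx /M raddfB /= tr_scalar_mx sP.
suff eS : eigenvalue P (sup S).
  by rewrite (le_trans (ubS x))// ler_wpM2r ?exprn_ge0 ?vnorm_ge0// ml.
rewrite /eigenvalue /eigenspace kermx_eq0 row_free_unit.
apply/negP => uPS.
have uM : M \in unitmx by rewrite /M -opprB -scaleN1r unitmxZ// unitrN1.
have [C' C'0 hC'] := qform_bound (invmx M).
have key z : vnorm z = 1 -> C'^-1 <= qform M z.
  move=> z1; have := psd_CauchySchwarz _ z (invmx M *m z) psdM.
  have sV : (invmx M)^T = invmx M by rewrite trmx_inv psdM.1.
  have -> : bform M z (invmx M *m z) = 1.
    by rewrite /bform -mulmxA mulKVmx// -sqr_vnorm z1 expr1n.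
  have -> : qform M (invmx M *m z) = qform (invmx M) z.
    by rewrite /qform -(mulmxA _ M) mulKVmx// trmx_mul sV.
  rewrite expr1n => h; rewrite -div1r ler_pdivrMr//.
  rewrite (le_trans h)// ler_wpM2l//; first exact: psdM.2.
  by have := hC' z; rewrite z1 expr1n mulr1; apply: le_trans; exact: ler_norm.
have : sup S <= sup S - C'^-1.
  apply: sup_le_ub; first exact: S0.1.
  move=> _ [z /= z1 <-]; have := key z z1.
  by rewrite qM z1 expr1n mulr1 lerBrDr addrC -lerBrDr.
by rewrite lerDl oppr_ge0 leNgt invr_gt0 C'0.
Qed.

(** Negation turns the smallest eigenvalue of [P] into the largest one of [- P]. *)
Lemma qform_ge_lambda_min P l x : symmx P -> is_lambda_min P l ->
  l * vnorm x ^+ 2 <= qform P x.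
Proof.
move=> sP [el ml].
have eN r : eigenvalue (- P) r -> eigenvalue P (- r).
  move=> /eigenvalueP[v vP v0]; apply/eigenvalueP; exists v => //.
  by rewrite scaleNr -vP mulmxN opprK.
have H : is_lambda_max (- P) (- l).
  split=> [|r /eN /ml]; last by rewrite lerNr.
  have [v vP v0] := eigenvalueP el; apply/eigenvalueP; exists v => //.
  by rewrite scaleNr -vP mulmxN.
have sN : symmx (- P) by rewrite /symmx raddfN /= sP.
have := qform_le_lambda_max _ _ x sN H.
by rewrite /qform mulmxN mulNmx mxE mulNr lerN2.
Qed.

(** [specnorm] is a supremum, so its set must first be shown bounded. The square of [vnorm (A *m z)]
    is the quadratic form of [A^T *m A], at most [C] on the unit ball, and [C <= (C + 1) ^+ 2]. *)
Lemma vnorm_mul_le_specnorm A x : vnorm (A *m x) <= specnorm A * vnorm x.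
Proof.
have E z : vnorm (A *m z) ^+ 2 = qform (A^T *m A) z.
  by rewrite sqr_vnorm trmx_mul /qform !mulmxA.
have [C C0 hC] := qform_bound (A^T *m A).
have [x0|x0] := eqVneq (vnorm x) 0.
  by rewrite (vnorm_eq0 _ x0) mulmx0 vnorm0 mulr0.
have xp : 0 < vnorm x by rewrite lt_def x0 vnorm_ge0.
have : vnorm (A *m ((vnorm x)^-1 *: x)) <= specnorm A.
  apply: ub_le_sup; last first.
    exists ((vnorm x)^-1 *: x) => //=.
    by rewrite vnormZ ger0_norm ?invr_ge0 ?vnorm_ge0// mulVf.
  exists (C + 1) => _ [z /= z1 <-].
  rewrite -(@ler_pXn2r _ 2)// ?nnegrE ?vnorm_ge0 ?addr_ge0 ?(ltW C0)//.
  rewrite E (le_trans (ler_norm _))// (le_trans (hC z))//.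
  have : vnorm z ^+ 2 <= 1 by rewrite exprn_ile1 ?vnorm_ge0.
  by nra.
by rewrite -scalemxAr vnormZ ger0_norm ?invr_ge0 ?vnorm_ge0// mulrC ler_pdivrMr.
Qed.

Lemma specnorm_ge_eigenvalue P l : symmx P -> eigenvalue P l ->
  2 * l <= specnorm (2%:R *: P).
Proof.
move=> sP /(eigenvalue_symm _ _ sP)[v v1 Pv].
have := vnorm_mul_le_specnorm (2%:R *: P) v.
rewrite v1 mulr1 -scalemxAl Pv scalerA vnormZ v1 mulr1; apply: le_trans.
exact: ler_norm.
Qed.

Lemma bform_le_specnorm P x y :
  2 * bform P x y <= specnorm (2%:R *: P) * vnorm x * vnorm y.
Proof.
rewrite mulrAC [leRHS]mulrC.
have -> : 2 * bform P x y = (x^T *m ((2%:R *: P) *m y)) 0 0.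
  by rewrite -scalemxAl -scalemxAr mxE mulmxA.
rewrite (le_trans (dot_le _ _))// ler_wpM2l ?vnorm_ge0//.
exact: vnorm_mul_le_specnorm.
Qed.

(** The difference quotient is exactly [2 * bform P x v + h * qform P v], so the limit needs no
    estimate. *)
Lemma derive_qform P x v : symmx P -> 'D_v (qform P) x = 2 * bform P x v.
Proof.
move=> sP; rewrite /derive; apply: cvg_lim => //.
apply: (@cvg_trans _ ((fun h : R => 2 * bform P x v + h * qform P v) @ 0^')).
  apply: near_eq_cvg; near=> h => /=.
  have h0 : h != 0 by near: h; exact: nbhs_dnbhs_neq.
  rewrite /shift /= !qformE bformDl !bformDr !bformZl !bformZr (bformC _ v x)//.
  by rewrite /GRing.scale/=; field.
have : 2 * bform P x v + h * qform P v @[h --> 0^'] -->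
    2 * bform P x v + 0 * qform P v.
  apply: cvgD; first exact: cvg_cst.
  by apply: cvgMl; apply: cvg_within_filter; exact: cvg_id.
by rewrite mul0r addr0.
Unshelve. all: by end_near. Qed.

End LinearAlgebra.

(** * One-sided derivatives and comparison arguments *)

Section RightDerivative.
Context {R : realType}.
Implicit Types (u v w : R -> R) (a b t m : R).

(** A bound on the upper right Dini derivative; the slack [e] replaces a limit superior. *)
Definition dini_le u t m := forall e, 0 < e ->
  \forall s \near t^'+, u s - u t <= (m + e) * (s - t).

Definition rderiv u t m := (u s - u t) / (s - t) @[s --> t^'+] --> m.

Lemma rderiv_dini u t m m' : m <= m' -> rderiv u t m -> dini_le u t m'.
Proof.
move=> mm' um e e0; near=> s.
have ts : 0 < s - t by rewrite subr_gt0; near: s; exact: nbhs_right_gt.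
rewrite -ler_pdivrMr// ltW//; near: s.
by apply: (cvgr_lt m um); rewrite ltr_pwDr.
Unshelve. all: by end_near. Qed.

Lemma dini_leD u v t m m' : dini_le u t m -> dini_le v t m' ->
  dini_le (fun s => u s + v s) t (m + m').
Proof.
move=> um vm e e0; near=> s.
have h1 : u s - u t <= (m + e / 2) * (s - t).
  by near: s; apply: um; rewrite divr_gt0.
have h2 : v s - v t <= (m' + e / 2) * (s - t).
  by near: s; apply: vm; rewrite divr_gt0.
nra.
Unshelve. all: by end_near. Qed.

Lemma rderiv_cvg u t m : rderiv u t m -> u s @[s --> t^'+] --> u t.
Proof.
move=> um.
have : u t + (u s - u t) / (s - t) * (s - t) @[s --> t^'+] --> u t + m * (t - t).
  apply: cvgD; first exact: cvg_cst.
  apply: cvgM => //; apply: cvgB; last exact: cvg_cst.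
  by apply: cvg_within_filter; exact: cvg_id.
rewrite subrr mulr0 addr0; apply: cvg_trans; apply: near_eq_cvg; near=> s.
have ts : 0 < s - t by rewrite subr_gt0; near: s; exact: nbhs_right_gt.
by field; rewrite gt_eqF.
Unshelve. all: by end_near. Qed.

Lemma rderiv_cst (x : R) t : rderiv (fun=> x) t 0.
Proof.
rewrite /rderiv; under eq_fun do rewrite subrr mul0r.
exact: cvg_cst.
Qed.

Lemma rderivD u v t m m' : rderiv u t m -> rderiv v t m' ->
  rderiv (fun s => u s + v s) t (m + m').
Proof.
move=> um vm; rewrite /rderiv.
under eq_fun => s do rewrite opprD addrACA mulrDl.
exact: cvgD.
Qed.

Lemma rderivM u v t m m' : rderiv u t m -> rderiv v t m' ->
  rderiv (fun s => u s * v s) t (m * v t + u t * m').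
Proof.
move=> um vm; rewrite /rderiv.
rewrite (_ : (fun s => _) = (fun s => (u s - u t) / (s - t) * v s +
  u t * ((v s - v t) / (s - t)))); last by apply/funext => s; ring.
apply: cvgD; apply: cvgM => //; [exact: rderiv_cvg vm|exact: cvg_cst].
Qed.

Lemma rderiv_sum (I : finType) (u : I -> R -> R) t (m : I -> R) :
  (forall i, rderiv (u i) t (m i)) ->
  rderiv (fun s => \sum_i u i s) t (\sum_i m i).
Proof.
move=> um; rewrite /rderiv.
under eq_fun => s do rewrite -sumrB mulr_suml.
apply: cvg_big => [|i _]; [exact: add_continuous|exact: um].
Qed.

Lemma within_rcvg u (b t : R) : {within `[0, b], continuous u} -> 0 <= t < b ->
  u s @[s --> t^'+] --> u t.
Proof.
move=> cu /andP[t0 tb].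
have [/(_ t) h1 h2 _] := (continuous_within_itvP u (le_lt_trans t0 tb)).1 cu.
move: t0; rewrite le_eqVlt => /predU1P[t0|t0]; first by rewrite -t0.
by apply: cvg_at_right_filter; apply: h1; rewrite in_itv/= t0.
Qed.

(** If [w t1 > 0], look at the supremum of the times up to [t1] with [w <= 0]. By continuity
    [w <= 0] there, and [w] stays nonpositive a little longer: by continuity if [w < 0], by
    hypothesis if [w = 0]. This contradicts the supremum. *)
Lemma le0_first_exit w a b :
  {within `[a, b], continuous w} -> w a <= 0 ->
  (forall t, a <= t < b -> w t = 0 -> \forall s \near t^'+, w s <= 0) ->
  forall t, a <= t <= b -> w t <= 0.
Proof.
move=> /subspace_continuousP cw wa hw t1 /andP[at1 t1b].
rewrite leNgt; apply/negP => wt1.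
pose A := [set t | a <= t <= t1 /\ w t <= 0].
have Aa : A a by split => //; rewrite lexx.
have supA : has_sup A by split; [exists a | exists t1 => t [/andP[]]].
have at0 : a <= sup A by apply: ub_le_sup => //; exact: supA.2.
have t01 : sup A <= t1 by apply: sup_le_ub; [exists a | move=> t [/andP[]]].
have t0ab : `[a, b]%classic (sup A) by rewrite /= in_itv/= at0 (le_trans t01).
have wt0 : w (sup A) <= 0.
  rewrite leNgt; apply/negP => wt0.
  have : nbhs (sup A) [set y | `[a, b]%classic y -> 0 < w y].
    exact: (cvgr_gt _ (cw _ t0ab) _ wt0).
  move=> /nbhs_ballP[e /= e0 he].
  have [x [/andP[ax xt1] wx] xe] := sup_adherent e0 supA.
  have xA : x <= sup A by apply: ub_le_sup; [exact: supA.2|split => //; rewrite ax].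
  have := he x; rewrite /ball/= ger0_norm ?subr_ge0// in_itv/= ax (le_trans xt1)//.
  by rewrite ltrBlDl -ltrBlDr => /(_ xe isT); rewrite ltNge wx.
have t0lt : sup A < t1.
  by rewrite lt_neqAle t01 andbT; apply: contraTneq wt1 => <-; rewrite -leNgt.
have : \forall s \near (sup A)^'+, w s <= 0.
  move: wt0; rewrite le_eqVlt => /orP[/eqP wt0|wt0].
    by apply: hw => //; rewrite at0 (lt_le_trans t0lt).
  have : nbhs (sup A) [set y | `[a, b]%classic y -> w y < 0].
    exact: (cvgr_lt _ (cw _ t0ab) _ wt0).
  move=> /nbhs_ballP[e /= e0 he].
  near=> s; apply/ltW/he.
    rewrite /ball/= distrC ger0_norm ?subr_ge0; last first.
      by apply/ltW; near: s; exact: nbhs_right_gt.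
    by rewrite ltrBlDl; near: s; apply: nbhs_right_lt; rewrite ltrDl.
  rewrite /= in_itv/=; apply/andP; split.
    by rewrite (le_trans at0)// ltW//; near: s; exact: nbhs_right_gt.
  by rewrite (le_trans _ t1b)// ltW//; near: s; exact: nbhs_right_lt.
move=> h; suff [s [[ts st] ws]] : exists s, (sup A < s /\ s < t1) /\ w s <= 0.
  suff : s <= sup A by rewrite leNgt ts.
  apply: ub_le_sup; first exact: supA.2.
  by split => //; rewrite (ltW st) (le_trans at0 (ltW ts)).
apply: (@filter_ex _ (sup A)^'+); near=> s; split; last by near: s.
by split; near: s; [exact: nbhs_right_gt|exact: nbhs_right_lt].
Unshelve. all: by end_near. Qed.

(** An exponential barrier of rate [K + 1] grows too fast for [u] to cross it, however small its
    initial value. As the barrier stays below [m], slopes matter only where [0 < u t < m]. *)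
Lemma dini_gronwall u b m K : 0 < m -> 0 <= K ->
  {within `[0, b], continuous u} -> u 0 <= 0 ->
  (forall t, 0 <= t < b -> 0 < u t < m -> dini_le u t (K * u t)) ->
  forall t, 0 <= t <= b -> u t <= 0.
Proof.
move=> m0 K0 cu u0 hu t /andP[t0 tb].
apply/ler_addgt0Pr => e e0; rewrite add0r.
pose E := expR ((K + 1) * b); have Ep : 0 < E by exact: expR_gt0.
(* This [d] keeps the barrier [z] below both [e] and [m / 2] up to time [b]. *)
pose d := Num.min e (m / 2) / E.
have d0 : 0 < d by rewrite divr_gt0// lt_min e0 divr_gt0.
pose z s := d * expR ((K + 1) * s).
have zE s : s <= b -> z s <= Num.min e (m / 2).
  move=> sb; rewrite /z -ler_pdivlMr ?expR_gt0// /d ler_pdivlMr ?expR_gt0//.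
  rewrite mulrAC ler_pdivrMr// ler_wpM2l ?le_min ?(ltW e0) ?divr_ge0 ?(ltW m0)//.
  by rewrite ler_expR ler_wpM2l// addr_ge0.
suff : u t - z t <= 0.
  rewrite subr_le0 => /le_trans; apply; apply: (le_trans (zE _ tb)).
  by rewrite ge_min lexx.
apply: (@le0_first_exit (fun s => u s - z s) 0 b) => //; last by rewrite t0 tb.
- move=> x; apply: cvgB; first exact: cu.
  have cz : continuous z.
    move=> y; apply: cvgM; first exact: cvg_cst.
    apply: (@cvg_comp _ _ _ ( *%R (K + 1)) expR); last exact: continuous_expR.
    by apply: cvgMr; exact: cvg_id.
  exact: (continuous_subspaceT cz).
- by rewrite subr_le0 (le_trans u0)// mulr_ge0 ?(ltW d0) ?expR_ge0.
move=> s /andP[s0 sb] /eqP; rewrite subr_eq0 => /eqP us.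
have zs : 0 < z s by rewrite mulr_gt0 ?expR_gt0.
have us_m : 0 < u s < m.
  rewrite us zs (le_lt_trans (zE _ (ltW sb)))// gt_min; apply/orP; right.
  by rewrite gtr_pMr// invf_lt1// ltr1n.
have sb' : 0 <= s < b by rewrite s0 sb.
(* The slack is the value of the barrier itself: at contact the slope of [u] is then at most
   [(K + 1) * z s], the slope of the tangent of [z], and the exponential lies above its tangent. *)
have h := hu s sb' us_m _ zs.
near=> r.
have h1 : u r - u s <= (K * u s + z s) * (r - s) by near: r.
have h2 : z s * (1 + (K + 1) * (r - s)) <= z r.
  rewrite /z -mulrA ler_wpM2l ?(ltW d0)//.
  have -> : (K + 1) * r = (K + 1) * s + (K + 1) * (r - s) by ring.
  by rewrite expRD ler_wpM2l ?expR_ge0// expR_ge1Dx.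
rewrite subr_le0; rewrite us in h1; lra.
Unshelve. all: by end_near. Qed.

Lemma dini_nonincreasing u b :
  {within `[0, b], continuous u} ->
  (forall t, 0 <= t < b -> dini_le u t 0) ->
  forall t, 0 <= t <= b -> u t <= u 0.
Proof.
move=> cu hu t tb; rewrite -subr_le0.
apply: (@dini_gronwall (fun t => u t - u 0) b 1 0) => //.
- by move=> x; apply: cvgB; [exact: cu|exact: cvg_cst].
- by rewrite subrr.
move=> s sb _ e e0; rewrite mul0r; near=> r.
rewrite opprB addrA subrK; near: r; exact: hu.
Unshelve. all: by end_near. Qed.

End RightDerivative.

(** * Continuity of norms, forms and real powers; Young's inequality *)

Section Continuity.
Context {R : realType} {n : nat}.

Lemma cvg_sumr {T : Type} {F : set_system T} {FF : Filter F} (I : finType)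
    (u : I -> T -> R) (l : I -> R) :
  (forall i, u i x @[x --> F] --> l i) ->
  \sum_i u i x @[x --> F] --> \sum_i l i.
Proof. by move=> ul; apply: cvg_big => // x; exact: add_continuous. Qed.

Lemma continuous_sumr {T : topologicalType} (I : finType) (u : I -> T -> R) :
  (forall i, continuous (u i)) -> continuous (fun x => \sum_i u i x).
Proof. by move=> uc x; apply: (@cvg_sumr _ (nbhs x) _) => i; exact: uc. Qed.

Lemma continuous_coord i : continuous (fun x : 'cV[R]_n => x i 0).
Proof. exact: coord_continuous. Qed.

Lemma continuous_vnorm : continuous (@vnorm R n).
Proof.
move=> x; apply: (@cvg_comp _ _ _ (fun x : 'cV[R]_n => \sum_i x i 0 ^+ 2) Num.sqrt
    (nbhs x) (nbhs (\sum_i x i 0 ^+ 2)));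
  last exact: sqrt_continuous.
apply: cvg_sumr => i.
by under eq_fun do rewrite expr2; apply: cvgM; exact: continuous_coord.
Qed.

Lemma continuous_qform (M : 'M[R]_n) : continuous (qform M).
Proof.
rewrite (_ : qform M = fun x => \sum_j \sum_i x i 0 * M i j * x j 0) => [|];
  last by apply/funext => x; exact: bform_sum.
apply: continuous_sumr => j; apply: continuous_sumr => i x.
apply: (@continuousM _ _ (fun x : 'cV[R]_n => x i 0 * M i j) (fun x => x j 0));
  last exact: continuous_coord.
apply: (@continuousM _ _ (fun x : 'cV[R]_n => x i 0) (fun=> M i j));
  [exact: continuous_coord|exact: cst_continuous].
Qed.

Lemma continuous_quadratic_field (L : 'M[R]_n) Rs i :
  continuous (fun x : 'cV[R]_n => (L *m x + Ups Rs x) i 0).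
Proof.
rewrite (_ : (fun x => _) = fun x : 'cV[R]_n =>
    \sum_j L i j * x j 0 + qform (Rs i) x) => [x|];
  last by apply/funext => x; rewrite !mxE.
apply: (@continuousD _ _ _ (fun x : 'cV[R]_n => \sum_j L i j * x j 0)
  (qform (Rs i))); last exact: continuous_qform.
apply: (@continuous_sumr 'cV[R]_n) => j {}x.
apply: (@continuousM _ _ (fun=> L i j) (fun x : 'cV[R]_n => x j 0));
  [exact: cst_continuous|exact: continuous_coord].
Qed.

(** At a positive limit the power is differentiable; the limit [0] is treated by hand. The exponent
    [0] is included because the power [p - 1] is taken later with [p = 1] allowed. *)
Lemma cvg_powR {T : Type} {F : set_system T} {FF : ProperFilter F}
    (u : T -> R) l p :
  0 <= p -> (forall x, 0 <= u x) -> u x @[x --> F] --> l ->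
  u x `^ p @[x --> F] --> l `^ p.
Proof.
rewrite le_eqVlt => /predU1P[<- _ _|p0 u0 ul].
  under eq_fun do rewrite powRr0; rewrite powRr0; exact: cvg_cst.
have : 0 <= l by apply: (cvgr_to_ge ul); exact: nearW.
rewrite le_eqVlt => /predU1P[l0|l0]; last first.
  apply: (@cvg_comp _ _ _ u (fun y => y `^ p) F (nbhs l)) => //.
  have /derivable1_diffP/differentiable_continuous : derivable (fun y => y `^ p) l 1.
    by apply: derivable_powR; rewrite in_itv/= l0.
  exact.
rewrite -l0 powR0 ?gt_eqF//; apply/cvgrPdist_le => e e0.
have e1 : 0 < e `^ p^-1 by rewrite powR_gt0.
near=> x; rewrite sub0r normrN ger0_norm ?powR_ge0//.
have -> : e = (e `^ p^-1) `^ p.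
  by rewrite -powRrM mulVf ?gt_eqF// powRr1// ltW.
apply: ge0_ler_powR; rewrite ?nnegrE ?u0 ?(ltW p0) ?(ltW e1)//.
have : `|l - u x| <= e `^ p^-1 by near: x; move/cvgrPdist_le : ul; apply.
by rewrite -l0 sub0r normrN ger0_norm.
Unshelve. all: by end_near. Qed.

(* Add the inequalities [1 + z <= expR z] for [z = (p - 1) * ln (x / y)] and,
   [p - 1] times, for [z = - ln (x / y)]. *)
Lemma powR_young (p x y : R) : 1 <= p -> 0 <= x -> 0 <= y ->
  p * y `^ (p - 1) * x <= x `^ p + (p - 1) * y `^ p.
Proof.
move=> p1 x0 y0; have p0 : 0 < p by rewrite (lt_le_trans _ p1).
have p10 : 0 <= p - 1 by rewrite subr_ge0.
have : 0 <= y by []; rewrite le_eqVlt => /predU1P[<-|yp].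
  (* Zero to the power [p - 1] is [1] when [p = 1] and [0] otherwise, hence the two cases. *)
  have [->|pn1] := eqVneq p 1; first by rewrite subrr powRr0 mul0r addr0 powRr1// !mul1r.
  rewrite powR0 ?subr_eq0// mulr0 mul0r addr_ge0 ?powR_ge0// mulr_ge0 ?powR_ge0//.
have : 0 <= x by []; rewrite le_eqVlt => /predU1P[<-|xp].
  by rewrite mulr0 addr_ge0 ?powR_ge0// mulr_ge0 ?powR_ge0.
pose l := ln (x / y).
have xE : x = y * expR l by rewrite lnK ?posrE ?divr_gt0// mulrC divfK// gt_eqF.
have yE : y `^ p = y * y `^ (p - 1) by rewrite mulr_powRB1.
have -> : x `^ p = y `^ p * expR (p * l).
  by rewrite {1}xE powRM ?expR_ge0// -expRM (mulrC l).
rewrite yE [X in _ * X <= _]xE.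
rewrite -subr_ge0.
have -> : y * y `^ (p - 1) * expR (p * l) + (p - 1) * (y * y `^ (p - 1)) -
    p * y `^ (p - 1) * (y * expR l) =
    y * y `^ (p - 1) * (expR (p * l) + (p - 1) - p * expR l) by ring.
rewrite mulr_ge0// ?mulr_ge0 ?powR_ge0// subr_ge0.
have h1 : expR l * (1 + (p - 1) * l) <= expR (p * l).
  have -> : p * l = l + (p - 1) * l by ring.
  by rewrite expRD ler_wpM2l ?expR_ge0// expR_ge1Dx.
have h2 : expR l * (1 - l) <= 1.
  by rewrite -[leRHS](expR0 R) -(subrr l) expRD ler_wpM2l ?expR_ge0// expR_ge1Dx.
nra.
Qed.

End Continuity.

(** * Integration and piecewise continuous signals *)

Section Integration.
Context {R : realType}.
Notation mu := (@lebesgue_measure R).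

(** The fundamental theorem of calculus at a point where [g] may jump: shortly after [t] the
    integrand is within [e] of its right limit, hence so is its mean over []t, s]]. *)
Lemma rderiv_Rintegral (g : R -> R) (b t l : R) :
  mu.-integrable `[0, b] (EFin \o g) -> 0 <= t < b ->
  g x @[x --> t^'+] --> l ->
  rderiv (fun s => Rintegral mu `[0, s] g) t l.
Proof.
move=> ig /andP[t0 tb] gl; apply/cvgrPdist_le => e e0.
have /nbhs_ballP[d /= d0 hd] : nbhs t [set x | t < x -> `|l - g x| <= e].
  by move/cvgrPdist_le : gl; apply.
near=> s.
have ts : t < s by near: s; exact: nbhs_right_gt.
have sb : s <= b by near: s; exact: nbhs_right_le.
have sd : s < t + d by near: s; apply: nbhs_right_lt; rewrite ltrDl.
have st0 : 0 < s - t by rewrite subr_gt0.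
have ig1 : mu.-integrable `[0, s] (EFin \o g).
  by apply: integrableS ig => //; apply: subset_itvl; rewrite bnd_simp.
have ig2 : mu.-integrable `]t, s] (EFin \o g).
  by apply: integrableS ig1 => //; apply: subset_itvr; rewrite bnd_simp.
have mts : fine (mu `]t, s]%classic) = s - t.
  by rewrite lebesgue_measure_itv/= lte_fin ts.
have mty : (mu `]t, s]%classic < +oo)%E.
  by rewrite lebesgue_measure_itv/= lte_fin ts -EFinD ltry.
have icst r : mu.-integrable `]t, s] (EFin \o cst r).
  apply: measurable_bounded_integrable => //.
  by exists `|r|; split => // M rM x _; exact: ltW.
have idif : mu.-integrable `]t, s] (EFin \o (fun x => l - g x)).
  rewrite (_ : _ \o _ = (EFin \o cst l) \- (EFin \o g))%E//.
  by apply: integrableB => //; exact: icst.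
rewrite Rintegral_itvB ?bnd_simp ?(ltW ts)//.
(* Writing [l] as the mean of a constant turns the difference into the mean of [l - g]. *)
rewrite -[X in X - _](mulfK (lt0r_neq0 st0) l) -mulrBl normrM normfV (gtr0_norm st0).
rewrite ler_pdivrMr// -mts -!Rintegral_cst//.
rewrite -RintegralB//; last exact: icst.
rewrite (le_trans (le_normr_Rintegral _ _))//.
apply: le_Rintegral => //.
- by have := integrable_abse idif; apply: eq_integrable.
- exact: icst.
move=> x /=; rewrite in_itv/= => /andP[tx xs]; apply: hd => //.
rewrite /ball/= distrC ger0_norm ?subr_ge0 ?(ltW tx)// ltrBlDl.
exact: le_lt_trans sd.
Unshelve. all: by end_near. Qed.

Lemma integrable_bounded_itv (g : R -> R) (b M : R) :
  measurable_fun `[0, b] g -> (forall t, 0 <= t <= b -> `|g t| <= M) ->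
  mu.-integrable `[0, b] (EFin \o g).
Proof.
move=> mg gM.
have mty : (mu `[0%R, b]%classic < +oo)%E.
  by rewrite lebesgue_measure_itv/=; case: ifP => _; rewrite -?EFinD ?ltry.
apply: measurable_bounded_integrable => //.
exists M; split; first exact: num_real.
by move=> N MN x /=; rewrite in_itv/= => /gM /le_trans; apply; exact: ltW.
Qed.

Lemma measurable_fun_finite (D : set R) (g : R -> R) :
  finite_set D -> measurable_fun D g.
Proof.
move=> fD mD Y mY; apply: countable_measurable => //.
by apply: finite_set_countable; apply: sub_finite_set fD => x [].
Qed.

Context {n : nat}.

Lemma piecewise_continuous_rlim (f : R -> 'cV[R]_n) (t : R) :
  piecewise_continuous f -> 0 <= t ->
  exists l : 'cV[R]_n, f x @[x --> t^'+] --> l.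
Proof.
move=> pf t0; have T0 : 0 < t + 1 by rewrite ltr_wpDl.
have [s [fc [fr _]]] := pf _ T0.
have [ts|ts] := boolP ((t \in s) || (t == 0)).
  by apply: fr => //; rewrite t0 ltrDl ltr01.
move: ts; rewrite negb_or => /andP[ts tn0]; exists (f t).
apply: cvg_at_right_filter; apply: fc => //.
by rewrite lt_neqAle eq_sym tn0 t0 ltrDl ltr01.
Qed.

(** Off finitely many points the signal is continuous on an open set, and every function on a finite
    set is measurable. *)
Lemma piecewise_continuous_measurable (f : R -> 'cV[R]_n) (h : 'cV[R]_n -> R) (b : R) :
  piecewise_continuous f -> continuous h -> 0 <= b ->
  measurable_fun `[0, b] (h \o f).
Proof.
(* The horizon [b + 1] makes [b] interior; [0] joins the exceptional points, since continuity is
   known only at positive times. *)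
move=> pf ch b0; have T0 : 0 < b + 1 by rewrite ltr_wpDl.
have [s [fc _]] := pf _ T0.
have fs : finite_set [set` 0 :: s] by exact: finite_seq.
pose D := `]0, b + 1[%classic `&` ~` [set` 0 :: s].
have oD : open D.
  apply: openI; first exact: interval_open.
  apply: closed_openC; apply: compact_closed; first exact: Rhausdorff.
  exact: finite_compact.
have mD : measurable D by exact: open_measurable.
have mF : measurable [set` 0 :: s].
  by apply: countable_measurable => //; exact: finite_set_countable.
apply: (@measurable_funS _ _ _ _ (D `|` [set` 0 :: s])).
- exact: measurableU.
- move=> x /=; rewrite in_itv/= => /andP[x0 xb].
  have [xs|xs] := boolP (x \in 0 :: s); [by right|left; split]; last exact/negP.
  rewrite /= in_itv/= lt_neqAle x0 andbT.
  move: xs; rewrite inE negb_or eq_sym => /andP[-> _] /=.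
  by rewrite (le_lt_trans xb)// ltrDl.
apply/measurable_funU => //; split; last exact: measurable_fun_finite.
apply: open_continuous_measurable_fun => // x.
rewrite inE => -[/=]; rewrite in_itv/= => xT /negP.
rewrite inE negb_or => /andP[_ xs].
apply: (@cvg_comp _ _ _ f h); last exact: ch.
exact: fc.
Qed.

End Integration.

(** * Right derivatives along a trajectory *)

Section Trajectory.
Context {R : realType} {n : nat}.
Notation mu := (@lebesgue_measure R).
Implicit Types (a f : R -> 'cV[R]_n) (P L : 'M[R]_n).

(** Agreement is asked only to the right of [t] because the integral equation holds only at
    nonnegative times. *)
Lemma eq_rderiv (u v : R -> R) (t m : R) : (forall s, t <= s -> u s = v s) ->
  rderiv v t m -> rderiv u t m.
Proof.
move=> uv; apply: cvg_trans; apply: near_eq_cvg; near=> s.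
have ts : t <= s by apply/ltW; near: s; exact: nbhs_right_gt.
by rewrite !uv.
Unshelve. all: by end_near. Qed.

Lemma within_comp (A : set R) a (h : 'cV[R]_n -> R) : continuous h ->
  {within A, continuous a} -> {within A, continuous (h \o a)}.
Proof. by move=> ch ca x; apply: (@cvg_comp _ _ _ a h); [exact: ca|exact: ch]. Qed.

(** The integral equation is differentiated from the right, so the right limit [phi] of the input
    appears instead of [f t]. The bound [M] makes the input integrable. *)
Lemma rderiv_solution L Rs f (a0 : 'cV[R]_n) a (tau M t : R) (phi : 'cV[R]_n) :
  is_solution L Rs f a0 a -> piecewise_continuous f ->
  (forall t, 0 <= t <= tau -> vnorm (f t) <= M) ->
  0 <= t < tau -> f x @[x --> t^'+] --> phi ->
  forall i, rderiv (fun s => a s i 0) t ((L *m a t + Ups Rs (a t) + phi) i 0).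
Proof.
move=> [ca ea] pf fM /andP[t0 tt] fphi i.
have tau0 : 0 <= tau by rewrite (le_trans t0)// ltW.
pose g s := (L *m a s + Ups Rs (a s)) i 0; pose fi s := f s i 0.
have ca' : {within `[0, tau], continuous a}.
  by apply: continuous_subspaceW ca; apply: subset_itvl; rewrite bnd_simp.
have cg : {within `[0, tau], continuous g}.
  exact: within_comp (continuous_quadratic_field L Rs i) ca'.
have ig : mu.-integrable `[0, tau] (EFin \o g).
  by apply: continuous_compact_integrable => //; exact: segment_compact.
have ifi : mu.-integrable `[0, tau] (EFin \o fi).
  apply: (@integrable_bounded_itv _ _ _ M).
    exact: (piecewise_continuous_measurable f (fun x => x i 0) tau pf (continuous_coord i)).
  by move=> s /fM; apply: le_trans; exact: ler_coord_vnorm.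
apply: (@eq_rderiv _ (fun s => a0 i 0 +
    Rintegral mu `[0, s] (fun s => (L *m a s + Ups Rs (a s) + f s) i 0))).
  by move=> s ts; apply: ea; exact: le_trans ts.
rewrite -[X in rderiv _ _ X]add0r; apply: rderivD; first exact: rderiv_cst.
apply: (@rderiv_Rintegral _ _ tau); last 2 first.
- by rewrite t0.
- rewrite (_ : (fun _ => _) = fun s => g s + fi s); last first.
    by apply/funext => s; rewrite /g /fi [LHS]mxE.
  rewrite mxE; apply: cvgD; last first.
    by apply: (@cvg_comp _ _ _ f (fun x : 'cV[R]_n => x i 0) _ (nbhs phi)) => //; exact: continuous_coord.
  by apply: within_rcvg cg _; rewrite t0.
rewrite (_ : EFin \o _ = (EFin \o g) \+ (EFin \o fi))%E; first exact: integrableD.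
by apply/funext => s; rewrite /= -EFinD /g /fi [in LHS]mxE.
Qed.

Lemma rderiv_qform P a (t : R) (d : 'cV[R]_n) : symmx P ->
  (forall i, rderiv (fun s => a s i 0) t (d i 0)) ->
  rderiv (fun s => qform P (a s)) t (2 * bform P (a t) d).
Proof.
move=> sP ad.
rewrite (_ : (fun s => _) = fun s => \sum_j \sum_i a s i 0 * P i j * a s j 0);
  last by apply/funext => s; exact: bform_sum.
(* By symmetry the factor [2] splits into the two terms of the product rule. *)
rewrite mulr_natl mulr2n -[X in X + _]bformC// !bform_sum -big_split/=.
apply: rderiv_sum => j; rewrite -big_split/=.
apply: rderiv_sum => i; apply: rderivM => //.
by rewrite -[X in rderiv _ _ X]addr0 -(mulr0 (a t i 0)); apply: rderivM => //; exact: rderiv_cst.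
Qed.

Lemma rderiv_sqrt (v : R -> R) (t m : R) : (forall s, 0 <= v s) -> 0 < v t ->
  rderiv v t m -> rderiv (fun s => Num.sqrt (v s)) t (m / (2 * Num.sqrt (v t))).
Proof.
move=> v0 vt vm.
have svt : 0 < Num.sqrt (v t) by rewrite sqrtr_gt0.
rewrite /rderiv.
rewrite (_ : (fun s => _) = fun s => (v s - v t) / (s - t) *
   (Num.sqrt (v s) + Num.sqrt (v t))^-1); last first.
  apply/funext => s.
  have -> : v s - v t = (Num.sqrt (v s) - Num.sqrt (v t)) *
      (Num.sqrt (v s) + Num.sqrt (v t)) by rewrite -subr_sqr !sqr_sqrtr.
  by rewrite [RHS]mulrAC mulfK// gt_eqF// ltr_wpDl// sqrtr_ge0.
apply: cvgM => //; rewrite mulr_natl mulr2n; apply: cvgV.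
  by rewrite gt_eqF// addr_gt0.
apply: cvgD; last exact: cvg_cst.
apply: (@cvg_comp _ _ _ v Num.sqrt _ (nbhs (v t))); first exact: rderiv_cvg vm.
exact: sqrt_continuous.
Qed.

(** The square root is not differentiable at [0], but the root of a quadratic form is positively
    homogeneous of degree one. The difference quotient is therefore its value at
    [(s - t)^-1 *: a s], which tends to [d]. *)
Lemma rderiv_sqrt_qform0 P a (t : R) (d : 'cV[R]_n) : a t = 0 ->
  (forall i, rderiv (fun s => a s i 0) t (d i 0)) ->
  rderiv (fun s => Num.sqrt (qform P (a s))) t (Num.sqrt (qform P d)).
Proof.
move=> at0 ad.
have q0 : qform P (a t) = 0 by rewrite at0 -(scale0r 0) qformZ expr0n mul0r.
have h : qform P ((s - t)^-1 *: a s) @[s --> t^'+] --> qform P d.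
  rewrite (_ : (fun s => _) = fun s => \sum_j \sum_i
    ((a s i 0 - a t i 0) / (s - t)) * P i j * ((a s j 0 - a t j 0) / (s - t))).
    rewrite qformE bform_sum; apply: cvg_sumr => j; apply: cvg_sumr => i.
    by apply: cvgM; [apply: cvgMl|]; exact: ad.
  apply/funext => s; rewrite qformE bform_sum.
  apply: eq_bigr => j _; apply: eq_bigr => i _.
  by rewrite at0 !mxE !subr0 ![(s - t)^-1 * _]mulrC.
rewrite /rderiv q0 sqrtr0.
have := cvg_comp _ _ h (@sqrt_continuous R _).
apply: cvg_trans; apply: near_eq_cvg; near=> s => /=.
have ts : 0 < s - t by rewrite subr_gt0; near: s; exact: nbhs_right_gt.
rewrite qformZ sqrtrM ?exprn_ge0 ?invr_ge0 ?(ltW ts)//.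
by rewrite sqrtr_sqr ger0_norm ?invr_ge0 ?(ltW ts)// subr0 mulrC.
Unshelve. all: by end_near. Qed.

End Trajectory.

(** * Gain estimates for a scalar differential inequality *)

Section ScalarGain.
Context {R : realType}.
Notation mu := (@lebesgue_measure R).
Implicit Types (u W h : R -> R).

Lemma dini_le_trans u (t m m' : R) : m <= m' -> dini_le u t m -> dini_le u t m'.
Proof.
move=> mm' um e e0; near=> s.
have ts : 0 <= s - t by rewrite subr_ge0 ltW//; near: s; exact: nbhs_right_gt.
apply: (@le_trans _ _ ((m + e) * (s - t))); first by near: s; exact: um.
by rewrite ler_wpM2r// lerD2r.
Unshelve. all: by end_near. Qed.

(** By convexity the increment of the power is at most the tangent slope at the later time [s] times
    [W s - W t]; right continuity of [W] then moves that slope back to [t]. *)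
Lemma dini_powR W (t m p : R) : 1 <= p -> (forall s, 0 <= W s) ->
  W s @[s --> t^'+] --> W t -> dini_le W t m ->
  dini_le (fun s => W s `^ p) t (p * W t `^ (p - 1) * m).
Proof.
move=> p1 W0 Wt Wm e e0.
have p0 : 0 < p by rewrite (lt_le_trans _ p1).
set Y := W t `^ (p - 1); have Y0 : 0 <= Y by exact: powR_ge0.
have pY : 0 <= p * Y by rewrite mulr_ge0// ltW.
(* Chosen so that [p * Y * d < e]; the added [1] covers [Y = 0]. *)
pose d := e / (2 * (p * Y + 1)).
have d0 : 0 < d by rewrite divr_gt0// mulr_gt0// ltr_wpDl.
have lim : p * W s `^ (p - 1) * (m + d) @[s --> t^'+] --> p * Y * (m + d).
  apply: cvgMl; apply: cvgMr; apply: cvg_powR => //; by rewrite subr_ge0.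
have ltd : p * Y * (m + d) < p * Y * m + e.
  rewrite mulrDr ltrD2l /d mulrA ltr_pdivrMr ?mulr_gt0 ?ltr_wpDl//; nra.
near=> s.
have ts : 0 < s - t by rewrite subr_gt0; near: s; exact: nbhs_right_gt.
have h1 : W s - W t <= (m + d) * (s - t) by near: s; exact: Wm.
have h2 : p * W s `^ (p - 1) * (m + d) < p * Y * m + e.
  by near: s; exact: (cvgr_lt _ lim).
have h3 := powR_young p (W t) (W s) p1 (W0 t) (W0 s).
have h4 := mulr_powRB1 (W0 s) p0.
set Z := W s `^ (p - 1) in h2 h3 h4 *.
have Z0 : 0 <= Z by exact: powR_ge0.
apply: (@le_trans _ _ (p * Z * (W s - W t))).
  by rewrite -h4; rewrite -h4 in h3; lra.
apply: (@le_trans _ _ (p * Z * ((m + d) * (s - t)))).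
  by rewrite ler_wpM2l// mulr_ge0// ltW.
by rewrite mulrA ler_wpM2r ?(ltW ts)// ltW.
Unshelve. all: by end_near. Qed.

(** Above the level [W 0 + k / c * S] the decay [c * W] outweighs the input term [k * S], so the
    excess has nonpositive slope there and Gronwall applies with [K = 0]. *)
Lemma sup_gain W (b c k S : R) : 0 < c -> 0 <= k -> 0 <= S ->
  {within `[0, b], continuous W} ->
  (forall t, 0 <= t < b -> dini_le W t (- c * W t + k * S)) ->
  0 <= W 0 ->
  forall t, 0 <= t <= b -> W t <= W 0 + k / c * S.
Proof.
move=> c0 k0 S0 cW hW W0 t tb; rewrite -subr_le0.
apply: (@dini_gronwall _ (fun s => W s - (W 0 + k / c * S)) b 1 0) => //.
- by move=> x; apply: cvgB; [exact: cW|exact: cvg_cst].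
- by rewrite opprD addrA subrr sub0r oppr_le0 mulr_ge0// divr_ge0// ltW.
move=> s sb /andP[+ _]; rewrite mul0r subr_gt0 => Ws.
suff le0 : - c * W s + k * S <= 0.
  have hs := dini_le_trans _ _ _ _ le0 (hW s sb).
  move=> e e0; near=> r; rewrite [leLHS](_ : _ = W r - W s); last by ring.
  by near: r; exact: hs.
have : c * (W 0 + k / c * S) <= c * W s by rewrite ler_pM2l// ltW.
have -> : c * (W 0 + k / c * S) = c * W 0 + k * S by field; rewrite gt_eqF.
have : 0 <= c * W 0 by rewrite mulr_ge0// ltW.
lra.
Unshelve. all: by end_near. Qed.

Lemma rderivZ (r : R) u (t m : R) : rderiv u t m -> rderiv (fun s => r * u s) t (r * m).
Proof.
move=> um; rewrite -[X in rderiv _ _ X]add0r -[X in rderiv _ _ (X + _)](mul0r (u t)).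
by apply: (@rderivM _ (fun=> r)) => //; exact: rderiv_cst.
Qed.

Lemma weighted_energy_le W h (b c k M p m : R) : 0 <= b -> 0 <= k -> 1 <= p -> 0 < m ->
  {within `[0, b], continuous W} -> (forall t, 0 <= W t) ->
  measurable_fun `[0, b] h -> (forall t, 0 <= h t) ->
  (forall t, 0 <= t <= b -> h t <= M) ->
  (forall t, 0 <= t < b -> exists2 l, h s @[s --> t^'+] --> l &
     dini_le W t (- c * W t + k * l)) ->
  (p * c - (p - 1) * k * m) * Rintegral mu `[0, b] (fun t => W t `^ p) <=
  W 0 `^ p + k * m `^ (1 - p) * Rintegral mu `[0, b] (fun t => h t `^ p).
Proof.
move=> b0 k0 p1 m0 cW W0 mh h0 hM hW.
have p0 : 0 < p by rewrite (lt_le_trans _ p1).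
pose Wp t := W t `^ p; pose hp t := h t `^ p.
have cWp : {within `[0, b], continuous Wp}.
  by move=> x; apply: cvg_powR; [exact: ltW|exact: W0|exact: cW].
have iW : mu.-integrable `[0, b] (EFin \o Wp).
  by apply: continuous_compact_integrable => //; exact: segment_compact.
have ih : mu.-integrable `[0, b] (EFin \o hp).
  apply: (@integrable_bounded_itv _ _ _ (M `^ p)).
    by apply: (measurableT_comp (measurable_powR p)).
  move=> t tb; rewrite ger0_norm ?powR_ge0// ge0_ler_powR ?nnegrE ?(ltW p0)//.
    by rewrite (le_trans (h0 t))// hM.
  exact: hM.
set al := p * c - _; set ka := k * _.
pose I t := Rintegral mu `[0, t] Wp; pose J t := Rintegral mu `[0, t] hp.
have cI : {within `[0, b], continuous I} by exact: parameterized_integral_continuous.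
have cJ : {within `[0, b], continuous J} by exact: parameterized_integral_continuous.
(* The Dini inequality is integrated by showing that this energy is nonincreasing; its values at [0]
   and [b] are compared and the final [Wp b] is dropped. *)
have : Wp b + (al * I b + - ka * J b) <= Wp 0 + (al * I 0 + - ka * J 0).
  apply: (@dini_nonincreasing _ (fun t => Wp t + (al * I t + - ka * J t)) b); last by rewrite b0 lexx.
    move=> x; apply: cvgD; first exact: cWp.
    by apply: cvgD; apply: cvgMr; [exact: cI|exact: cJ].
  move=> t tb; have [l hl Wl] := hW t tb.
  have l0 : 0 <= l by apply: (cvgr_to_ge hl); exact: nearW.
  have Wt := within_rcvg _ _ _ cW tb.
  apply: (@dini_le_trans _ _ (p * W t `^ (p - 1) * (- c * W t + k * l) +
      (al * Wp t + - ka * (l `^ p)))).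
    (* Young's inequality for [l] and [m * W t], divided by the power [p - 1] of [m], produces the
       power [1 - p] in [ka]. *)
    have y0 : 0 <= m * W t by rewrite mulr_ge0 ?(ltW m0).
    have := powR_young p l (m * W t) p1 l0 y0.
    rewrite !powRM ?(ltW m0)// -(mulr_powRB1 (W0 t) p0) -(mulr_powRB1 (ltW m0) p0).
    rewrite /al /ka /Wp -(mulr_powRB1 (W0 t) p0) -(opprB p 1) powRN.
    set Y := W t `^ (p - 1); set z := m `^ (p - 1).
    have z0 : 0 < z by rewrite powR_gt0.
    have zV : z^-1 * z = 1 by rewrite mulVf ?gt_eqF.
    have zV0 : 0 <= z^-1 by rewrite invr_ge0 ltW.
    move=> yg; have := ler_wpM2l k0 (ler_wpM2l zV0 yg).
    have -> : z^-1 * (p * (z * Y) * l) = (z^-1 * z) * (p * Y * l) by ring.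
    have -> : z^-1 * (l `^ p + (p - 1) * (m * z * (W t * Y))) =
      z^-1 * l `^ p + (z^-1 * z) * ((p - 1) * (m * (W t * Y))) by ring.
    rewrite zV !mul1r -subr_ge0 => yg2; rewrite -oppr_ge0.
    apply: le_trans yg2 _; rewrite le_eqVlt; apply/orP; left; apply/eqP; ring.
  apply: dini_leD; first exact: dini_powR.
  apply: dini_leD; apply: rderiv_dini (lexx _) _; apply: rderivZ; apply: (rderiv_Rintegral _ b) => //.
    by apply: cvg_powR => //; exact: ltW.
  by apply: cvg_powR => //; exact: ltW.
have -> : I 0 = 0 by rewrite /I set_itv1 Rintegral_set1.
have -> : J 0 = 0 by rewrite /J set_itv1 Rintegral_set1.
have : 0 <= Wp b by exact: powR_ge0.
move=> Wb0; rewrite !mulr0 !addr0 => H.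
suff : al * I b <= Wp 0 + ka * J b by [].
lra.
Qed.

Lemma Lp_gain W h (b c k M p : R) : 0 <= b -> 0 < c -> 0 <= k -> 1 <= p ->
  {within `[0, b], continuous W} -> (forall t, 0 <= W t) ->
  measurable_fun `[0, b] h -> (forall t, 0 <= h t) ->
  (forall t, 0 <= t <= b -> h t <= M) ->
  (forall t, 0 <= t < b -> exists2 l, h s @[s --> t^'+] --> l &
     dini_le W t (- c * W t + k * l)) ->
  (Rintegral mu `[0, b] (fun t => W t `^ p)) `^ p^-1 <=
  W 0 * (c * p)^-1 `^ p^-1 +
  k / c * (Rintegral mu `[0, b] (fun t => h t `^ p)) `^ p^-1.
Proof.
move=> b0 c0 k0 p1 cW W0 mh h0 hM hW.
have p0 : 0 < p by rewrite (lt_le_trans _ p1).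
have we m m0 := weighted_energy_le W h b c k M p m b0 k0 p1 m0 cW W0 mh h0 hM hW.
move: we; set I := Rintegral _ _ _; set J := Rintegral _ _ _ => we.
have I0 : 0 <= I by apply: Rintegral_ge0 => x _; exact: powR_ge0.
have J0 : 0 <= J by apply: Rintegral_ge0 => x _; exact: powR_ge0.
have XK (x : R) : 0 <= x -> (x `^ p^-1) `^ p = x.
  by move=> x0; rewrite -powRrM mulVf ?gt_eqF// powRr1.
have IE := esym (XK _ I0); have JE := esym (XK _ J0).
clearbody I J; set X := I `^ p^-1 in IE *; set H := J `^ p^-1 in JE *.
have X0 : 0 <= X by exact: powR_ge0.
have H0 : 0 <= H by exact: powR_ge0.
set B := W 0 * _.
have B0 : 0 <= B by rewrite mulr_ge0// powR_ge0.
have BE : B `^ p = W 0 `^ p / (c * p).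
  by rewrite powRM ?powR_ge0// XK// invr_ge0 mulr_ge0// ltW.
clearbody X H B; rewrite {}IE {}JE in we.
(* The weight must be positive even when [J = 0], so [H] is enlarged to a positive [H'] and the
   weight is [H' / X]. *)
have main H' : 0 < H' -> H <= H' -> X <= B + k / c * H'.
  move=> H'0 HH'; rewrite leNgt; apply/negP => ltX.
  have G0 : 0 <= k / c * H' by rewrite mulr_ge0 ?(ltW H'0)// divr_ge0// ltW.
  have Xp : 0 < X by apply: le_lt_trans ltX; exact: addr_ge0.
  have m0 : 0 < H' / X by rewrite divr_gt0.
  have := we _ m0.
  have HHp : H `^ p <= H' `^ p by rewrite ge0_ler_powR ?nnegrE ?(ltW p0) ?(ltW H'0).
  have -> : (H' / X) `^ (1 - p) = X `^ (p - 1) / H' `^ (p - 1).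
    rewrite -(opprB p 1) powRN powRM ?(ltW H'0) ?invr_ge0//.
    have -> : X^-1 `^ (p - 1) = (X `^ (p - 1))^-1.
      by rewrite -powR_inv1// -powRrM mulN1r powRN.
    by rewrite invfM invrK mulrC.
  set Y := X `^ (p - 1); set Z := H' `^ (p - 1).
  have Y0 : 0 < Y by rewrite powR_gt0.
  have Z0 : 0 < Z by rewrite powR_gt0.
  rewrite -(mulr_powRB1 X0 p0) -/Y => e1.
  have e2 : k * (Y / Z) * H `^ p <= k * Y * H'.
    rewrite -[leRHS](_ : k * (Y / Z) * H' `^ p = _); last first.
      by rewrite -(mulr_powRB1 (ltW H'0) p0) -/Z; field; rewrite gt_eqF.
    by rewrite ler_wpM2l// mulr_ge0// divr_ge0// ltW.
  have e3 : (p * c - (p - 1) * k * (H' / X)) * (X * Y) =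
      p * c * X * Y - (p - 1) * k * H' * Y by field; rewrite gt_eqF.
  have e4 : W 0 `^ p = c * p * B `^ p by rewrite BE; field; rewrite !gt_eqF.
  have e5 : k * Y * H' = c * Y * (k / c * H') by field; rewrite gt_eqF.
  (* The inequality assumed for contradiction gives [B <= X], so a factor [Y] can be split off and
     cancelled at the end. *)
  have e6 : B `^ p <= B * Y.
    rewrite -(mulr_powRB1 B0 p0) ler_wpM2l// ge0_ler_powR ?nnegrE ?subr_ge0//.
    by apply: le_trans (ltW ltX); rewrite lerDl.
  set G := k / c * H' in ltX G0 e5.
  have cp : 0 < c * p by rewrite mulr_gt0.
  have e7 : c * p * (X * Y) <= c * p * (B * Y + G * Y).
    apply: (@le_trans _ _ (c * p * B `^ p + p * (k * Y * H'))).
      by move: e1; rewrite e3 -e4 => e1; lra.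
    rewrite e5 mulrDr lerD ?ler_pM2l//; lra.
  move: e7; rewrite ler_pM2l// -mulrDl ler_pM2r// => e7.
  by move: ltX; rewrite ltNge e7.
apply/ler_addgt0Pr => e e0.
(* This enlargement of [H] costs [e * (k / (k + 1))], at most [e]; the [k + 1] avoids a division by
   zero. *)
have d0 : 0 < e * c / (k + 1) by rewrite divr_gt0 ?mulr_gt0// ltr_wpDl.
have := main (H + e * c / (k + 1)); rewrite ltr_wpDl// lerDl (ltW d0).
move=> /(_ isT isT) /le_trans; apply.
rewrite mulrDr addrA lerD2l.
have -> : k / c * (e * c / (k + 1)) = e * (k / (k + 1)).
  by field; rewrite !gt_eqF// ltr_wpDl.
by rewrite ler_piMr ?(ltW e0)// ler_pdivrMr ?mul1r ?lerDl// ltr_wpDl.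
Qed.

End ScalarGain.

(** * Dissipation slightly outside the ball *)

Section Dissipation.
Context {R : realType} {n : nat}.
Implicit Types (x y : 'cV[R]_n) (P L : 'M[R]_n).

Lemma UpsZ (Rs : 'I_n -> 'M[R]_n) (r : R) x :
  Ups Rs (r *: x) = r ^+ 2 *: Ups Rs x.
Proof. by apply/colP => i; rewrite !mxE qformZ. Qed.

Lemma vnorm_rlim_le (f : R -> 'cV[R]_n) (tau M t : R) (phi : 'cV[R]_n) :
  (forall t, 0 <= t <= tau -> vnorm (f t) <= M) -> 0 <= t < tau ->
  f x @[x --> t^'+] --> phi -> vnorm phi <= M.
Proof.
move=> fM /andP[t0 tt] fphi.
have h : vnorm (f x) @[x --> t^'+] --> vnorm phi.
  by apply: (@cvg_comp _ _ _ f (@vnorm R n) _ (nbhs phi)) => //; exact: continuous_vnorm.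
apply: (cvgr_to_le h); near=> s; apply: fM; apply/andP; split.
  by rewrite (le_trans t0)// ltW//; near: s; exact: nbhs_right_gt.
by near: s; exact: nbhs_right_le.
Unshelve. all: by end_near. Qed.

(* The field is the sum of a linear and a quadratic part, so that the
   dissipation inequality on the ball, applied to the radial projection of
   [x], still controls the growth of [V] slightly outside of the ball. *)
Lemma dissipation_outside P L (Rs : 'I_n -> 'M[R]_n) (delta eps : R) :
  0 < delta -> 0 < eps ->
  (forall x, vnorm x <= delta ->
     2 * bform P x (L *m x + Ups Rs x) <= - (eps * vnorm x ^+ 2)) ->
  exists2 C : R, 0 <= C & forall x, delta <= vnorm x <= 2 * delta ->
     2 * bform P x (L *m x + Ups Rs x) <=
     - (eps * vnorm x ^+ 2) + C * (vnorm x - delta).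
Proof.
move=> d0 e0 hx; have [C C0 hC] := qform_bound (P *m L).
(* On the shell [2 * C * s ^+ 2 <= 8 * C * delta ^+ 2], and the factor [(s - delta) / delta] cancels
   one [delta]. *)
exists (8 * C * delta); first by rewrite !mulr_ge0// ltW.
move=> x /andP[dx xd].
have := hC x; have := vnorm_ge0 x.
have := hx ((delta / vnorm x) *: x).
set s := vnorm x in dx xd *; have s0 : 0 < s by exact: lt_le_trans dx.
rewrite vnormZ ger0_norm ?divr_ge0 ?(ltW d0) ?(ltW s0)// -/s.
have sn0 : s != 0 by rewrite gt_eqF.
rewrite divfK// lexx UpsZ -scalemxAr !bformDr !bformZl !bformZr => /(_ isT).
have -> : qform (P *m L) x = bform P x (L *m x).
  by rewrite qformE /bform !mulmxA.
set q2 := bform P x (L *m x); set q3 := bform P x (Ups Rs x).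
set r := delta / s => h1 _ h2.
have r0 : 0 < r by rewrite divr_gt0.
have rs : r * s = delta by rewrite /r divfK.
have h3 : 2 * (q2 + r * q3) <= - (eps * s ^+ 2).
  have : r ^+ 2 * (2 * (q2 + r * q3)) <= r ^+ 2 * (- (eps * s ^+ 2)).
    apply: le_trans (le_trans h1 _); rewrite le_eqVlt; apply/orP; left; apply/eqP.
      ring.
    by rewrite -rs; ring.
  by rewrite ler_pM2l// exprn_gt0.
have h4 : 2 * (r * q3) <= 2 * C * s ^+ 2.
  have : - q2 <= C * s ^+ 2 by apply: le_trans h2; rewrite -normrN ler_norm.
  have : 0 <= eps * s ^+ 2 by rewrite mulr_ge0 ?exprn_ge0 ?(ltW e0) ?(ltW s0).
  lra.
have h5 : s ^+ 2 <= 4 * delta ^+ 2.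
  have -> : 4 * delta ^+ 2 = (2 * delta) ^+ 2 by ring.
  by rewrite ler_pXn2r ?nnegrE ?(ltW s0) ?mulr_ge0 ?(ltW d0).
have h6 : (s - delta) / delta * (2 * (r * q3)) <= (s - delta) / delta * (8 * C * delta ^+ 2).
  rewrite ler_wpM2l ?divr_ge0 ?subr_ge0 ?(ltW d0)//; apply: (le_trans h4).
  have := ler_wpM2l (ltW C0) h5; lra.
have h7 : (s - delta) / delta * (8 * C * delta ^+ 2) = 8 * C * delta * (s - delta).
  by field; rewrite gt_eqF.
(* This uses [1 - r = (s - delta) / delta * r]. *)
have h8 : 2 * (q2 + q3) = 2 * (q2 + r * q3) + (s - delta) / delta * (2 * (r * q3)).
  by rewrite /r; field; rewrite sn0 gt_eqF.
lra.
Qed.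

End Dissipation.

(** * Invariance of the sublevel set and decay of the square root of V *)

Section Lyapunov.
Context {R : realType} {n : nat}.
Variables (L : 'M[R]_n) (Rs : 'I_n -> 'M[R]_n) (P : 'M[R]_n).
Variables (delta eps lmin lmax : R).
Hypotheses (d0 : 0 < delta) (e0 : 0 < eps) (lmin0 : 0 < lmin) (lminmax : lmin <= lmax).
Hypothesis sP : symmx P.
Hypothesis Vlo : forall x, lmin * vnorm x ^+ 2 <= qform P x.
Hypothesis Vhi : forall x, qform P x <= lmax * vnorm x ^+ 2.
Let N := specnorm (2%:R *: P).
Hypothesis Nge : 2 * lmax <= N.
Hypothesis dissip : forall x, vnorm x <= delta ->
  2 * bform P x (L *m x + Ups Rs x) <= - (eps * vnorm x ^+ 2).
Variables (a0 : 'cV[R]_n) (f a : R -> 'cV[R]_n) (tau : R).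
Hypothesis V0 : qform P a0 <= lmin * delta ^+ 2.
Hypothesis pf : piecewise_continuous f.
Hypothesis sol : is_solution L Rs f a0 a.
Hypothesis fr : forall t, 0 <= t <= tau ->
  vnorm (f t) <= (lmin * eps * delta) / (lmax * N).

Let lmax0 : 0 < lmax. Proof. exact: lt_le_trans lminmax. Qed.
Let N0 : 0 < N. Proof. by apply: lt_le_trans Nge; rewrite mulr_gt0. Qed.

Lemma solution0 : a 0 = a0.
Proof.
by apply/colP => i; rewrite (sol.2 _ (lexx 0)) set_itv1 Rintegral_set1 addr0.
Qed.

Lemma solution_continuous : {within `[0, tau], continuous a}.
Proof. by apply: continuous_subspaceW sol.1; apply: subset_itvl; rewrite bnd_simp. Qed.

Lemma rderiv_V t phi : 0 <= t < tau -> f x @[x --> t^'+] --> phi ->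
  rderiv (fun s => qform P (a s)) t
    (2 * bform P (a t) (L *m a t + Ups Rs (a t)) + 2 * bform P (a t) phi).
Proof.
move=> tt fphi; rewrite -mulrDr -bformDr; apply: rderiv_qform => //.
exact: rderiv_solution sol pf fr tt fphi.
Qed.

(** Above the threshold the input term [F] is absorbed by [eps * s ^+ 2]. What remains is
    nonpositive in the ball and at most [C * (s - delta)] outside it, which is a multiple of the
    excess of V over the threshold. *)
Lemma sublevel_invariant t : 0 <= t <= tau -> qform P (a t) <= lmin * delta ^+ 2.
Proof.
have [C C0 hC] := dissipation_outside P L Rs delta eps d0 e0 dissip.
move=> tt; rewrite -subr_le0.
have ld0 : 0 < lmin * delta ^+ 2 by rewrite mulr_gt0 ?exprn_gt0.
(* The window [m = lmin * delta ^+ 2] keeps V below twice the threshold, so that [s <= 2 * delta] as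
   [dissipation_outside] requires. *)
apply: (@dini_gronwall _ (fun s => qform P (a s) - lmin * delta ^+ 2) tau
  (lmin * delta ^+ 2) (C / (lmin * delta))) => //.
- by rewrite divr_ge0// mulr_ge0// ltW.
- move=> x; apply: cvgB; last exact: cvg_cst.
  exact: (within_comp _ _ _ (continuous_qform P) solution_continuous).
- by rewrite solution0 subr_le0.
move=> {tt}t tt /andP[u0 um].
have [phi fphi] := piecewise_continuous_rlim f t pf (andP tt).1.
have phir := vnorm_rlim_le f tau _ t phi fr tt fphi.
have := rderivD _ _ _ _ _ (rderiv_V _ _ tt fphi) (rderiv_cst (- (lmin * delta ^+ 2)) t).
apply: rderiv_dini; rewrite addr0.
have := hC (a t); have := dissip (a t).
have := bform_le_specnorm P (a t) phi; rewrite -/N.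
have := Vlo (a t); have := Vhi (a t); have := vnorm_ge0 (a t).
set s := vnorm (a t); set G := 2 * bform P (a t) (L *m _ + _).
set F := 2 * bform P (a t) phi; set u := qform P (a t) in u0 um *.
move=> s0 ushi uslo hF hG1 hG2.
have s2 : lmin * s ^+ 2 <= lmin * (2 * delta ^+ 2) by lra.
have sd : s <= 2 * delta.
  rewrite -(@ler_pXn2r _ 2)// ?nnegrE ?mulr_ge0 ?(ltW d0)//.
  move: s2; rewrite ler_pM2l// => /le_trans; apply; rewrite exprMn.
  by have := exprn_gt0 2 d0; lra.
(* Above the threshold [lmin * delta ^+ 2 <= lmax * s ^+ 2]; multiplying by [lmin <= lmax] gives the
   square of this claim. It is what the input bound is tuned to. *)
have ls : lmin * delta <= lmax * s.
  rewrite -(@ler_pXn2r _ 2)// ?nnegrE ?mulr_ge0 ?(ltW d0) ?(ltW lmin0) ?(ltW lmax0)//.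
  have -> : (lmin * delta) ^+ 2 = lmin * (lmin * delta ^+ 2) by ring.
  have -> : (lmax * s) ^+ 2 = lmax * (lmax * s ^+ 2) by ring.
  by rewrite ler_pM ?(ltW ld0) ?(ltW lmin0)//; lra.
have hF' : F <= eps * s ^+ 2.
  apply: (le_trans hF).
  apply: (@le_trans _ _ (N * s * ((lmin * eps * delta) / (lmax * N)))).
    by rewrite ler_wpM2l// mulr_ge0// ltW.
  have -> : N * s * ((lmin * eps * delta) / (lmax * N)) =
      eps * s * (lmin * delta / lmax) by field; rewrite !gt_eqF.
  rewrite expr2 [leRHS]mulrA ler_wpM2l// ?mulr_ge0 ?(ltW e0)//.
  by rewrite ler_pdivrMr// (mulrC s).
have [sle|slt] := leP s delta.
  have := hG1 sle => hG; apply: (@le_trans _ _ 0); first lra.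
  by rewrite mulr_ge0 ?divr_ge0 ?mulr_ge0 ?(ltW d0) ?(ltW lmin0) ?(ltW u0).
have := hG2; rewrite sd (ltW slt) => /(_ isT) hG.
apply: (@le_trans _ _ (C * (s - delta))); first lra.
rewrite -mulrA ler_wpM2l// mulrC ler_pdivlMr ?mulr_gt0//.
(* Multiplied by [lmin], the right-hand side is at most the excess of V over the threshold. *)
have h : (s - delta) * delta <= s ^+ 2 - delta ^+ 2.
  by rewrite subr_sqr ler_wpM2l ?subr_ge0 ?(ltW slt)// lerDr.
have := ler_wpM2l (ltW lmin0) h; lra.
Qed.

Lemma vnorm_le_delta t : 0 <= t <= tau -> vnorm (a t) <= delta.
Proof.
move=> /sublevel_invariant h.
rewrite -(@ler_pXn2r _ 2)// ?nnegrE ?vnorm_ge0 ?(ltW d0)//.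
by rewrite -(ler_pM2l lmin0) (le_trans (Vlo _)).
Qed.

Let W s := Num.sqrt (qform P (a s)).

Lemma qform_ge0 x : 0 <= qform P x.
Proof. by apply: le_trans (Vlo x); rewrite mulr_ge0 ?exprn_ge0 ?vnorm_ge0 ?(ltW lmin0). Qed.

Lemma vnorm_le_sqrtV x : Num.sqrt lmin * vnorm x <= Num.sqrt (qform P x).
Proof.
rewrite -[X in _ * X]ger0_norm ?vnorm_ge0// -sqrtr_sqr -sqrtrM ?(ltW lmin0)//.
by rewrite ler_sqrt ?qform_ge0.
Qed.

Lemma sqrtV_le_vnorm x : Num.sqrt (qform P x) <= Num.sqrt lmax * vnorm x.
Proof.
rewrite -[X in _ * X]ger0_norm ?vnorm_ge0// -sqrtr_sqr -sqrtrM ?(ltW lmax0)//.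
by rewrite ler_sqrt ?mulr_ge0 ?exprn_ge0 ?vnorm_ge0 ?(ltW lmax0).
Qed.

(** Where V is positive, its derivative is divided by [2 * W t]. Where V vanishes, so do the state
    and the unforced field, and the slope is the root of [qform P phi]. *)
Lemma dini_sqrtV t phi : 0 <= t < tau -> f x @[x --> t^'+] --> phi ->
  dini_le W t (- (eps / (2 * lmax)) * W t + N / (2 * Num.sqrt lmin) * vnorm phi).
Proof.
move=> tt fphi; have := andP tt => -[t0 ttau].
have sl0 : 0 < Num.sqrt lmin by rewrite sqrtr_gt0.
have sL : vnorm (a t) <= delta by apply: vnorm_le_delta; rewrite t0 ltW.
have [V0t|Vp] := eqVneq (qform P (a t)) 0.
  have at0 : a t = 0.
    apply: vnorm_eq0; apply/eqP; rewrite eq_le vnorm_ge0 andbT.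
    by rewrite -(ler_pM2l sl0) mulr0 (le_trans (vnorm_le_sqrtV _))// V0t sqrtr0.
  have h := rderiv_solution L Rs f a0 a tau _ t phi sol pf fr tt fphi.
  apply: rderiv_dini (rderiv_sqrt_qform0 _ _ _ _ at0 h).
  rewrite /W V0t sqrtr0 mulr0 add0r at0 mulmx0 add0r.
  rewrite -[X in Ups _ X](scale0r 0) UpsZ expr0n scale0r add0r.
  rewrite (le_trans (sqrtV_le_vnorm _))// ler_wpM2r ?vnorm_ge0//.
  (* What is left is that twice the product of the roots of [lmin] and [lmax] is at most [N]; it
     follows from [lmin <= lmax] and [2 * lmax <= N]. *)
  rewrite ler_pdivlMr ?mulr_gt0//.
  apply: le_trans Nge; rewrite mulrCA ler_pM2l//.
  rewrite -[leRHS]sqr_sqrtr ?(ltW lmax0)// expr2 ler_wpM2l ?sqrtr_ge0//.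
  exact: ler_wsqrtr.
have {}Vp : 0 < qform P (a t) by rewrite lt_def Vp qform_ge0.
have W0 : 0 < W t by rewrite sqrtr_gt0.
apply: rderiv_dini (rderiv_sqrt _ _ _ (fun s => qform_ge0 (a s)) Vp (rderiv_V _ _ tt fphi)).
rewrite -/(W t) ler_pdivrMr ?mulr_gt0//.
have hG := dissip _ sL.
have hF := bform_le_specnorm P (a t) phi; rewrite -/N in hF.
apply: (le_trans (lerD hG hF)).
have h1 : eps / lmax * W t ^+ 2 <= eps * vnorm (a t) ^+ 2.
  rewrite /W sqr_sqrtr ?qform_ge0// -mulrA ler_wpM2l ?(ltW e0)//.
  by rewrite mulrC ler_pdivrMr// mulrC.
have h2 : N * vnorm (a t) * vnorm phi <= N * (W t / Num.sqrt lmin) * vnorm phi.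
  rewrite ler_wpM2r ?vnorm_ge0// ler_wpM2l ?(ltW N0)// ler_pdivlMr// mulrC.
  exact: vnorm_le_sqrtV.
have -> : (- (eps / (2 * lmax)) * W t + N / (2 * Num.sqrt lmin) * vnorm phi) * (2 * W t) =
  - (eps / lmax * W t ^+ 2) + N * (W t / Num.sqrt lmin) * vnorm phi.
  by field; rewrite !gt_eqF.
lra.
Qed.

End Lyapunov.

(** * Norms of truncated signals *)

Section SignalNorm.
Context {R : realType} {n : nat}.
Notation mu := (@lebesgue_measure R).
Implicit Types g : R -> 'cV[R]_n.

Lemma sigLp_trunc g (tau p : R) : 0 < p ->
  mu.-integrable `[0, tau] (fun t => (vnorm (g t) `^ p)%:E) ->
  sigLp p%:E (trunc g tau) =
  ((Rintegral mu `[0, tau] (fun t => vnorm (g t) `^ p)) `^ p^-1)%:E.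
Proof.
move=> p0 ig; rewrite /sigLp -poweR_EFin; congr poweR.
rewrite /Rintegral fineK; last exact: integrable_fin_num.
rewrite [LHS]integral_mkcond [RHS]integral_mkcond; apply: eq_integral => t _.
rewrite /patch !mem_setE !in_itv/= andbT /trunc.
have [t0|t0] //= := leP 0 t; have [tt|tt] //= := leP t tau.
by rewrite vnorm0 powR0 ?gt_eqF.
Qed.

Lemma sigLoo_trunc_le g (tau M : R) : 0 <= tau ->
  (forall t, 0 <= t <= tau -> vnorm (g t) <= M) ->
  (sigLp +oo%E (trunc g tau) <= M%:E)%E.
Proof.
move=> tau0 gM; apply: ub_ereal_sup => _ [t t0 <-].
move: t0; rewrite /= in_itv/= andbT => t0.
rewrite lee_fin /trunc; case: ifPn => tt; first by rewrite gM// t0.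
(* Beyond [tau] the truncation is zero, and [0 <= M] is read off at time [0]. *)
by rewrite vnorm0 (le_trans (vnorm_ge0 (g 0)))// gM// lexx.
Qed.

(** Turns the extended-real norm of the input into a real pointwise bound, the form [sup_gain]
    takes. *)
Lemma sigLoo_truncP g (tau M : R) : 0 <= tau ->
  (forall t, 0 <= t <= tau -> vnorm (g t) <= M) ->
  exists S : R, [/\ 0 <= S, sigLp +oo%E (trunc g tau) = S%:E &
    forall t, 0 <= t <= tau -> vnorm (g t) <= S].
Proof.
move=> tau0 gM; rewrite /sigLp; set A := [set _ | _ in _].
have ubA t : 0 <= t <= tau -> ((vnorm (g t))%:E <= ereal_sup A)%E.
  move=> /andP[t0 tt]; apply: ereal_sup_ubound; exists t => /=.
    by rewrite in_itv/= t0.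
  by rewrite /trunc tt.
have A0 : (0 <= ereal_sup A)%E.
  by apply: le_trans (ubA 0 _); rewrite ?lee_fin ?vnorm_ge0 ?lexx.
have AM : (ereal_sup A <= M%:E)%E by exact: sigLoo_trunc_le gM.
have fA : ereal_sup A \is a fin_num.
  by rewrite ge0_fin_numE// (le_lt_trans AM)// ltry.
exists (fine (ereal_sup A)); split; first exact: fine_ge0.
  by rewrite fineK.
by move=> t /ubA; rewrite -lee_fin fineK.
Qed.

End SignalNorm.

(** * Input-output stability of the quadratic system *)

Theorem theorem3 (R : realType) (n : nat) (hn : (0 < n)%N)
  (L : 'M[R]_n) (Rs : 'I_n -> 'M[R]_n)
  (hL : hurwitz L)
  (hRs : forall m, symmx (Rs m))
  (hener : forall a : 'cV[R]_n, (a^T *m Ups Rs a) 0 0 = 0)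
  (delta : R) (hdelta : 0 < delta)
  (D : set 'cV[R]_n) (hD : [set a | vnorm a <= delta] `<=` D)
  (P : 'M[R]_n) (eps : R) (Q : 'M[R]_n)
  (hP : symmx P) (heps : 0 < eps) (hQ : psd Q)
  (hV1 : forall a, D a -> 0 <= Vsos P a - eps * (a^T *m a) 0 0)
  (hV2 : forall a, D a ->
     0 <= - ('D_(L *m a + Ups Rs a) (Vsos P) a
             + (delta ^+ 2 - (a^T *m a) 0 0) * qform Q a
             + eps * (a^T *m a) 0 0))
  (lmin lmax : R) (hlmin : is_lambda_min P lmin) (hlmax : is_lambda_max P lmax)
  (p : \bar R) (hp : (1 <= p)%E)
  (a0 : 'cV[R]_n) (ha0 : vnorm a0 <= delta * Num.sqrt (lmin / lmax))
  (f : R -> 'cV[R]_n) (hf : Lpe p f)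
  (a : R -> 'cV[R]_n) (ha : is_solution L Rs f a0 a) :
  let gamma := (lmax * specnorm (2%:R *: P)) / (lmin * eps) in
  let beta := vnorm a0 * Num.sqrt (lmax / lmin) * rho p lmax eps in
  let y := a in
  forall tau : R, 0 <= tau ->
    (forall t, 0 <= t <= tau ->
       vnorm (f t) <= (lmin * eps * delta) / (lmax * specnorm (2%:R *: P))) ->
    (forall t, 0 <= t <= tau -> vnorm (a t) <= delta) /\
    (sigLp p (trunc y tau) <= gamma%:E * sigLp p (trunc f tau) + beta%:E)%E.
Proof.
move=> gamma beta y tau tau0 fr.
have [pf _] := hf.
have emin := hlmin.1; have emax := hlmax.1.
have minmax : lmin <= lmax by exact: hlmin.2.
have Vlo x : lmin * vnorm x ^+ 2 <= qform P x by exact: qform_ge_lambda_min.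
have Vhi x : qform P x <= lmax * vnorm x ^+ 2 by exact: qform_le_lambda_max.
(* The bound on V is known only on [D], so a unit eigenvector is scaled to length [delta]; this
   yields [eps <= lmin]. *)
have lmin0 : 0 < lmin.
  have [v v1 Pv] := eigenvalue_symm _ _ hP emin.
  have := hV1 (delta *: v).
  rewrite /Vsos -sqr_vnorm vnormZ v1 mulr1 (gtr0_norm hdelta) qformZ.
  rewrite (qform_eigenvector _ _ _ Pv) v1 expr1n mulr1 mulrC -mulrBl.
  rewrite pmulr_lge0 ?exprn_gt0// subr_ge0 => h.
  apply: lt_le_trans heps (h _); apply: hD => /=.
  by rewrite vnormZ v1 mulr1 gtr0_norm.
have lmax0 : 0 < lmax by exact: lt_le_trans minmax.
pose N := specnorm (2%:R *: P); rewrite -/N in fr.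
have Nge : 2 * lmax <= N by exact: specnorm_ge_eigenvalue.
have N0 : 0 < N by apply: lt_le_trans Nge; rewrite mulr_gt0.
have dissip x : vnorm x <= delta ->
    2 * bform P x (L *m x + Ups Rs x) <= - (eps * vnorm x ^+ 2).
  move=> xd; have := hV2 x (hD x xd).
  rewrite derive_qform// -sqr_vnorm oppr_ge0.
  have : 0 <= (delta ^+ 2 - vnorm x ^+ 2) * qform Q x.
    rewrite mulr_ge0 ?hQ.2// subr_ge0 ler_pXn2r ?nnegrE ?vnorm_ge0//.
    exact: ltW.
  lra.
have V0 : qform P a0 <= lmin * delta ^+ 2.
  apply: (le_trans (Vhi a0)).
  have : vnorm a0 ^+ 2 <= (delta * Num.sqrt (lmin / lmax)) ^+ 2.
    by rewrite ler_pXn2r ?nnegrE ?vnorm_ge0 ?mulr_ge0 ?sqrtr_ge0 ?(ltW hdelta).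
  rewrite exprMn (@sqr_sqrtr _ (lmin / lmax)) ?divr_ge0 ?(ltW lmin0) ?(ltW lmax0)// => h.
  have := ler_wpM2l (ltW lmax0) h; move=> /le_trans; apply.
  by rewrite le_eqVlt; apply/orP; left; apply/eqP; field; rewrite gt_eqF.
have bnd := vnorm_le_delta L Rs P delta eps lmin lmax hdelta heps lmin0 minmax
  hP Vlo Vhi Nge dissip a0 f a tau V0 pf ha fr.
split => //.
have dW := dini_sqrtV L Rs P delta eps lmin lmax hdelta heps lmin0 minmax
  hP Vlo Vhi Nge dissip a0 f a tau V0 pf ha fr.
pose W s := Num.sqrt (qform P (a s)).
have W0 s : 0 <= W s by exact: sqrtr_ge0.
have aW s : vnorm (a s) <= (Num.sqrt lmin)^-1 * W s.
  rewrite mulrC ler_pdivlMr ?sqrtr_gt0// mulrC.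
  exact: vnorm_le_sqrtV.
have ca := solution_continuous L Rs a0 f a tau ha.
have cW : {within `[0, tau], continuous W}.
  apply: (within_comp _ a (fun x => Num.sqrt (qform P x))) ca => x.
  apply: (@cvg_comp _ _ _ (qform P) Num.sqrt (nbhs x) (nbhs (qform P x))).
    exact: continuous_qform.
  exact: sqrt_continuous.
have W00 : (Num.sqrt lmin)^-1 * W 0 <= vnorm a0 * Num.sqrt (lmax / lmin).
  rewrite mulrC /W (solution0 L Rs a0 f a ha).
  rewrite sqrtrM ?(ltW lmax0)// sqrtrV ?(ltW lmin0)// mulrA ler_wpM2r ?invr_ge0 ?sqrtr_ge0//.
  rewrite [leRHS]mulrC; exact: sqrtV_le_vnorm lmin0 minmax Vhi a0.
set c := eps / (2 * lmax) in dW; set k := N / (2 * Num.sqrt lmin) in dW.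
have c0 : 0 < c by rewrite divr_gt0// mulr_gt0.
have k0 : 0 <= k by rewrite divr_ge0 ?(ltW N0)// mulr_ge0// sqrtr_ge0.
(* One root of [lmin] comes from [k], the other from passing from [W] back to the state. *)
have gE : (Num.sqrt lmin)^-1 * (k / c) = gamma.
  have sl0 : Num.sqrt lmin != 0 by rewrite gt_eqF// sqrtr_gt0.
  have -> : gamma = lmax * N / (Num.sqrt lmin ^+ 2 * eps) by rewrite sqr_sqrtr ?ltW.
  rewrite /k /c.
  by field; rewrite sl0 !gt_eqF.
have hlim t phi : f x @[x --> t^'+] --> phi -> vnorm (f x) @[x --> t^'+] --> vnorm phi.
  by move=> h; apply: (@cvg_comp _ _ _ f (@vnorm R n) _ (nbhs phi)) => //; exact: continuous_vnorm.
(* [hp] excludes [-oo]; the exponent [+oo] is treated first. *)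
case: p hp @beta {hf} => [p| |] //; last first.
  move=> _ beta.
  have [S [S0 -> fS]] := sigLoo_truncP _ _ _ tau0 fr.
  rewrite -EFinM -EFinD; apply: sigLoo_trunc_le => // t tt.
  apply: (le_trans (aW t)).
  have : W t <= W 0 + k / c * S.
    apply: (sup_gain W tau c k S) => // {tt}t tt.
    have [phi fphi] := piecewise_continuous_rlim f t pf (andP tt).1.
    apply: dini_le_trans (dW t phi tt fphi).
    by rewrite lerD2l ler_wpM2l//; apply: vnorm_rlim_le fS tt fphi.
  move=> h; have sV : 0 <= (Num.sqrt lmin)^-1 by rewrite invr_ge0 sqrtr_ge0.
  have := ler_wpM2l sV h; rewrite mulrDr mulrA gE.
  by rewrite /beta /rho mulr1; lra.
rewrite lee_fin => p1 beta.
have p0 : 0 < p by rewrite (lt_le_trans _ p1).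
have mf : measurable_fun `[0, tau] (fun t => vnorm (f t)).
  exact: (piecewise_continuous_measurable f (@vnorm R n) tau pf continuous_vnorm).
have cap : {within `[0, tau], continuous (fun t => vnorm (a t) `^ p)}.
  move=> x; apply: cvg_powR; [exact: ltW|by move=> z; exact: vnorm_ge0|].
  exact: (within_comp _ a (@vnorm R n) continuous_vnorm ca).
have cWp : {within `[0, tau], continuous (fun t => W t `^ p)}.
  by move=> x; apply: cvg_powR; [exact: ltW|exact: W0|exact: cW].
have ia : lebesgue_measure.-integrable `[0, tau] (fun t => (vnorm (a t) `^ p)%:E).
  by apply: continuous_compact_integrable => //; exact: segment_compact.
have iW : lebesgue_measure.-integrable `[0, tau] (fun t => (W t `^ p)%:E).
  by apply: continuous_compact_integrable => //; exact: segment_compact.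
have iF : lebesgue_measure.-integrable `[0, tau] (fun t => (vnorm (f t) `^ p)%:E).
  apply: (@integrable_bounded_itv _ _ _ ((lmin * eps * delta / (lmax * N)) `^ p)).
    exact: (measurableT_comp (measurable_powR p)).
  move=> t tb; rewrite ger0_norm ?powR_ge0// ge0_ler_powR ?nnegrE ?(ltW p0) ?vnorm_ge0//.
    by rewrite (le_trans (vnorm_ge0 (f t)))// fr.
  exact: fr.
rewrite !sigLp_trunc// -EFinM -EFinD lee_fin.
have := Lp_gain W (fun t => vnorm (f t)) tau c k _ p tau0 c0 k0 p1 cW W0 mf
  (fun t => vnorm_ge0 (f t)) fr.
have hdW t : 0 <= t < tau ->
    exists2 l, vnorm (f s) @[s --> t^'+] --> l & dini_le W t (- c * W t + k * l).
  move=> tt; have [phi fphi] := piecewise_continuous_rlim f t pf (andP tt).1.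
  by exists (vnorm phi); [exact: hlim|exact: dW].
move=> /(_ hdW) h.
have sV : 0 <= (Num.sqrt lmin)^-1 by rewrite invr_ge0 sqrtr_ge0.
apply: (@le_trans _ _ ((Num.sqrt lmin)^-1 *
    (Rintegral lebesgue_measure `[0, tau] (fun t => W t `^ p)) `^ p^-1)).
  (* The factor is written as a [p]-th root so that it can be moved under the integral and [aW]
     applied pointwise. *)
  rewrite -[X in X * _](_ : ((Num.sqrt lmin)^-1 `^ p) `^ p^-1 = _); last first.
    by rewrite -powRrM divff ?gt_eqF// powRr1.
  rewrite -powRM ?powR_ge0//; last by apply: Rintegral_ge0 => x _; exact: powR_ge0.
  rewrite ge0_ler_powR ?nnegrE ?invr_ge0 ?(ltW p0)//.
  - by apply: Rintegral_ge0 => x _; exact: powR_ge0.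
  - by rewrite mulr_ge0 ?powR_ge0//; apply: Rintegral_ge0 => x _; exact: powR_ge0.
  rewrite -RintegralZl//; apply: le_Rintegral => //.
    rewrite (_ : _ \o _ =
      fun x => (((Num.sqrt lmin)^-1 `^ p)%:E * (W x `^ p)%:E)%E)//.
    exact: integrableZl.
  move=> x _; rewrite -powRM// ge0_ler_powR ?nnegrE ?vnorm_ge0 ?(ltW p0) ?mulr_ge0//.
apply: (le_trans (ler_wpM2l sV h)).
rewrite mulrDr [in X in X + _ <= _]mulrA [in X in _ + X]mulrA gE addrC lerD2l.
rewrite /beta /rho.
(* With this value of [c] the initial-state term carries exactly the factor [rho]. *)
have -> : (c * p)^-1 = 2 * lmax / (eps * p) by rewrite /c; field; rewrite !gt_eqF.
by rewrite ler_wpM2r ?powR_ge0.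
Qed.
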